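(* Let $m\ne 2$. With $h^i$ denoting total (even plus odd) complex dimension, $$h^0(\mathcal{T}_{\mathbb{P}^{1|m}})=(m+2)^2-1=m^2+4m+3,$$ $$h^1(\mathcal{T}_{\mathbb{P}^{1|m}})=(m+2)\left[(m+2)+(m-4)2^{m-1}\right]-(m-2)2^{m-1}-1.$$
   Context: $\mathbb{P}^{1|m}$ is the complex projective superspace of dimension $1|m$, $m\ge 0$, covered by two affine charts with coordinates $(z|\theta_1,\ldots,\theta_m)$ and $(w|\psi_1,\ldots,\psi_m)$ related by $z=1/w$, $\theta_i=\psi_i/w$. $\mathcal{T}_{\mathbb{P}^{1|m}}$ is its tangent sheaf (sheaf of superderivations of the structure sheaf). *)

(* Defs.v *)
From HB Require Import structures.
From mathcomp Require Import all_boot all_order all_algebra.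
From mathcomp Require Import boolp classical_sets cardinality reals complex.

Set Implicit Arguments.
Unset Strict Implicit.
Unset Printing Implicit Defensive.

Import GRing.Theory.

Local Open Scope classical_set_scope.
Local Open Scope ring_scope.

Section ProjectiveSuperspace.

Variables (C : closedFieldType) (m : nat).

(* The closed points of P^1 with the Zariski topology: Some a is the point
   z = a, and None is the point w = 0, i.e. z = infinity. *)
Definition P1 : Type := option C.

(* The nonempty open sets are the cofinite ones.  As C is infinite, any two of
   them intersect.  The empty open set is left out throughout, since discarding
   the empty members of a cover does not affect Cech cohomology. *)
Definition zopen (U : set P1) : Prop := finite_set (~` U).

(* The function field C(z) of P^1, and the two affine coordinates in it. *)
Definition ratfun := {fraction {poly C}}.
Definition zcoord : ratfun := tofrac 'X.
Definition wcoord : ratfun := zcoord^-1.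

Definition scalar (c : C) : ratfun := tofrac c%:P.

(* p(t) for a polynomial p over C and a rational function t *)
Definition peval (p : {poly C}) (t : ratfun) : ratfun := (map_poly scalar p).[t].

(* f is regular at the point with coordinate a of the affine line with
   coordinate t. *)
Definition regular (t : ratfun) (a : C) (f : ratfun) : Prop :=
  exists p q : {poly C}, q.[a] != 0 /\ f = peval p t / peval q t.

(* The superalgebra C(z)[theta_1, ..., theta_m], the stalk of the structure sheaf
   at the generic point of P^{1|m}: f stands for \sum_I f_I theta_I, where
   theta_I is the product of the theta_i for i in I in increasing order. *)
Definition superfun := {ffun {set 'I_m} -> ratfun}.

(* theta_A theta_B = (-1)^(inversions A B) theta_(A U B) for disjoint A and B *)
Definition inversions (A B : {set 'I_m}) : nat :=
  #|[set ij : 'I_m * 'I_m | [&& ij.1 \in A, ij.2 \in B & (ij.2 < ij.1)%N]]|.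

Definition smul (f g : superfun) : superfun :=
  [ffun S : {set 'I_m} => \sum_(A : {set 'I_m} | A \subset S)
     (-1) ^+ inversions A (S :\: A) * f A * g (S :\: A)].

Definition sscale (c : C) (f : superfun) : superfun :=
  [ffun I => scalar c * f I].

(* f is homogeneous of parity b (false for even, true for odd). *)
Definition homog (b : bool) (f : superfun) : Prop :=
  forall I : {set 'I_m}, odd #|I| != b -> f I = 0.

(* Regularity of a superfunction at a point, read in a chart containing it.
   Since theta_i = psi_i / w, the coefficient of psi_I in the second chart is
   f_I w^(-|I|). *)
Definition sregular (x : P1) (f : superfun) : Prop :=
  match x with
  | Some a => forall I : {set 'I_m}, regular zcoord a (f I)
  | None => forall I : {set 'I_m}, regular wcoord 0 (f I * wcoord ^- #|I|)
  end.

(* The structure sheaf of P^{1|m}, as a subsheaf of the constant sheaf with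
   value superfun; its restriction maps are inclusions. *)
Definition structure_sheaf (U : set P1) (f : superfun) : Prop :=
  forall x, U x -> sregular x f.

(* C-linear superderivations of parity b, and all superderivations *)
Definition homog_superder (b : bool) (D : superfun -> superfun) : Prop :=
  [/\ forall (c : C) (f g : superfun), D (sscale c f + g) = sscale c (D f) + D g,
      forall (b' : bool) (f : superfun), homog b' f -> homog (b (+) b') (D f)
    & forall (b' : bool) (f g : superfun), homog b' f ->
        D (smul f g) = smul (D f) g +
          (if b && b' then - smul f (D g) else smul f (D g))].

Definition superder (D : superfun -> superfun) : Prop :=
  exists D0 D1 : superfun -> superfun,
    [/\ homog_superder false D0, homog_superder true D1
      & forall f, D f = D0 f + D1 f].

(* The tangent sheaf on a nonempty open set U.  A superderivation of the sheaf of
   algebras O|_U is a family of superderivations of the O(V), for V open in U,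
   compatible with restriction.  As restrictions are inclusions and superfun is
   the union of the O(V) with V nonempty, such a family is the same thing as one
   superderivation of superfun that maps every O(V) into itself. *)
Definition tangent_sheaf (U : set P1) (D : superfun -> superfun) : Prop :=
  superder D /\
  forall V, zopen V -> V `<=` U ->
    forall f, structure_sheaf V f -> structure_sheaf V (D f).

(* h^0 = n: the global sections have a basis with n elements. *)
Definition tangent_h0 (n : nat) : Prop :=
  exists b : 'I_n -> superfun -> superfun,
    (forall k, tangent_sheaf setT (b k)) /\
    forall D, tangent_sheaf setT D ->
      exists! c : {ffun 'I_n -> C}, forall f, D f = \sum_(k < n) sscale (c k) (b k f).

Record cover : Type := Cover {
  cidx : Type;
  copen : cidx -> set P1;
  copenP : forall i, zopen (copen i);
  coverP : forall x, exists i, copen i x }.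

(* Cech 1-cocycles of the tangent sheaf; s i j is a section over U_i `&` U_j. *)
Definition cocycle (U : cover) (s : cidx U -> cidx U -> superfun -> superfun) : Prop :=
  (forall i j, tangent_sheaf (copen i `&` copen j) (s i j)) /\
  (forall i j k f, s i k f = s i j f + s j k f).

Definition refines (W U : cover) (r : cidx W -> cidx U) : Prop :=
  forall k, copen k `<=` copen (r k).

(* Cocycles s and s', on possibly different covers, have the same class in
   H^1, the colimit over all open covers of the Cech cohomology groups: they
   differ by a coboundary on a common refinement. *)
Definition cohomologous (U U' : cover)
    (s : cidx U -> cidx U -> superfun -> superfun)
    (s' : cidx U' -> cidx U' -> superfun -> superfun) : Prop :=
  exists (W : cover) (r : cidx W -> cidx U) (r' : cidx W -> cidx U')
         (t : cidx W -> superfun -> superfun),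
    [/\ refines r, refines r', forall k, tangent_sheaf (copen k) (t k)
      & forall k l f, s (r k) (r l) f - s' (r' k) (r' l) f = t k f - t l f].

(* h^1 = n: H^1 has a basis with n elements.  Finitely many classes are always
   represented by cocycles on a single cover. *)
Definition tangent_h1 (n : nat) : Prop :=
  exists (U : cover) (b : 'I_n -> cidx U -> cidx U -> superfun -> superfun),
    (forall k, cocycle (b k)) /\
    forall (V : cover) (s : cidx V -> cidx V -> superfun -> superfun), cocycle s ->
      exists! c : {ffun 'I_n -> C},
        cohomologous s (fun i j f => \sum_(k < n) sscale (c k) (b k i j f)).

End ProjectiveSuperspace.

(* Main.v *)
Require Import Defs.
From HB Require Import structures.
From mathcomp Require Import all_boot all_order all_algebra.
From mathcomp Require Import boolp classical_sets cardinality reals complex.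
From mathcomp Require Import ring zify.

Set Implicit Arguments.
Unset Strict Implicit.
Unset Printing Implicit Defensive.

Import GRing.Theory.

Local Open Scope ring_scope.

(** A superderivation D of the generic stalk is determined by the superfunctions
    f = D z and g_i = D theta_i, and every family (f, g_1, ..., g_m) occurs
    ([superder_vfield], [vfield_superder]).  So the tangent sheaf is the sheaf of
    those families of rational functions f_I, g_(i, J) that satisfy a condition
    at each point: at a finite point all coefficients are regular, and at
    infinity, where D w = - w^2 f and D psi_i = w (g_i - w f theta_i), these
    two superfunctions are regular ([tangent_sheafP]).

    The condition at infinity ties f_I to the g_(i, J) with J = I U {i}, for i
    outside I.  In such a block f generates a quotient O(2 - k) and the g_i a
    subbundle of copies of O(- k), where k is the cardinal of I, but the
    extension does not split: if I is not everything, choosing one index j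
    outside I, the functions f_I - z g_j and g_j (up to signs) are coordinates on
    two copies of O(1 - k), and the differences g_i - g_j on copies of O(- k).
    The remaining g_(i, J), with i outside J, are sections of O(1 - |J|).  This
    polynomial and invertible change of coordinates presents the tangent sheaf
    as a direct sum of line bundles O(2 - e) ([local_field_lines]).

    For each line bundle both cohomology groups are explicit: H^0 has the basis
    z^j with j < 3 - e, and H^1 the basis w^(j + 1) with j < e - 3
    ([tangent_h0_lines], [tangent_h1_lines]).  To see the latter for the
    cohomology of arbitrary covers, a cocycle is written s_ij = eta_i - eta_j
    with eta_i rational; a rational function with prescribed polar parts removes
    the poles on the affine line, and the class is the polar part left at
    infinity, modulo polynomials.

    It remains to add up the dimensions ([h0_count], [h1_count]).  The block of
    the full set I is special: it has no index j and contributes one O(2 - m)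
    without correction.  This shifts the sum for h^0 by a second difference of
    the function 3 - e (truncated at 0) around e = m + 1; this vanishes unless
    m = 2.  The sum for h^1 follows, as h^0 - h^1 is the sum of the 3 - e. *)

(** * Rational functions *)

HB.instance Definition _ (C : closedFieldType) :=
  GRing.RMorphism.copy (@Defs.scalar C) (@tofrac {poly C} \o polyC).

Section RationalFunctions.

Variable C : closedFieldType.
Local Notation K := (ratfun C).
Local Notation z := (zcoord C).
Local Notation w := (wcoord C).
Local Notation tf := (@tofrac {poly C}).
Implicit Types (p q : {poly C}) (f g t : K) (a c : C) (x : P1 C).

Lemma tofrac_neq0 q : q != 0 -> tf q != 0.
Proof. by rewrite tofrac_eq0. Qed.

Lemma zcoord_neq0 : z != 0.
Proof. by rewrite tofrac_neq0 ?polyX_eq0. Qed.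

Lemma wcoord_neq0 : w != 0.
Proof. by rewrite invr_eq0 zcoord_neq0. Qed.

Lemma mulzw : z * w = 1.
Proof. exact: mulfV zcoord_neq0. Qed.

Lemma pevalE p t : peval p t = \sum_(i < size p) Defs.scalar p`_i * t ^+ i.
Proof.
rewrite /peval (@horner_coef_wide _ (size p)) ?size_map_poly //.
by apply: eq_bigr => i _; rewrite coef_map.
Qed.

Lemma peval_zcoord p : peval p z = tf p.
Proof.
rewrite /peval map_poly_comp /=; have -> : z = tf 'X by [].
by rewrite horner_map /= -/(comp_poly _ _) comp_polyXr.
Qed.

Lemma pevalD p q t : peval (p + q) t = peval p t + peval q t.
Proof. by rewrite /peval rmorphD hornerD. Qed.
Lemma pevalM p q t : peval (p * q) t = peval p t * peval q t.
Proof. by rewrite /peval rmorphM hornerM. Qed.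
Lemma pevalC c t : peval c%:P t = Defs.scalar c.
Proof. by rewrite /peval map_polyC hornerC. Qed.
Lemma pevalX t : peval 'X t = t.
Proof. by rewrite /peval map_polyX hornerX. Qed.

(** Reading a polynomial backwards exchanges the two coordinates. *)
Lemma peval_wcoord (n : nat) p : (size p <= n)%N ->
  peval p w = tf (\poly_(i < n) p`_(n.-1 - i)) * w ^+ n.-1.
Proof.
move=> le_p_n; rewrite pevalE (big_ord_widen n (fun i => Defs.scalar p`_i * w ^+ i)) //.
rewrite big_mkcond /= poly_def rmorph_sum /= mulr_suml (reindex_inj rev_ord_inj) /=.
apply: eq_bigr => i _; have in1 : (i <= n.-1)%N by rewrite -ltnS (ltn_predK (ltn_ord i)).
have -> : (n - i.+1 = n.-1 - i)%N by rewrite -{1}(ltn_predK (ltn_ord i)).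
rewrite -mul_polyC rmorphM rmorphXn /= -mulrA.
have -> : (tf 'X) ^+ i * w ^+ n.-1 = w ^+ (n.-1 - i).
  rewrite -{1}(subnK in1) exprD mulrCA -exprMn mulfV ?expr1n ?mulr1 //.
  exact: zcoord_neq0.
by case: ltnP => // /(nth_default 0) ->; rewrite polyC0 rmorph0 mul0r.
Qed.

Lemma peval_wcoord_neq0 q : q != 0 -> peval q w != 0.
Proof.
move=> q0; rewrite (peval_wcoord (leqnn _)) mulf_neq0 //; last first.
  by apply/expf_neq0/wcoord_neq0.
apply: tofrac_neq0; apply/eqP => /polyP/(_ 0%N).
rewrite coef_poly coef0 subn0 size_poly_gt0 q0 => /eqP.
by rewrite -/(lead_coef q) lead_coef_eq0 (negbTE q0).
Qed.

(** The local ring of P^1 at x. *)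
Definition regat x f : Prop :=
  if x is Some a then regular z a f else regular w 0 f.

Arguments regat : simpl never.

(** Both kinds of points are treated at once: the local ring is that of a point on
    the affine line with a transcendental coordinate t. *)
Lemma regatP x : exists (t : K) (a : C),
  (forall q, q != 0 -> peval q t != 0) /\ (forall f, regat x f <-> regular t a f).
Proof.
case: x => [a|]; last by exists w, 0; split=> //; apply: peval_wcoord_neq0.
by exists z, a; split=> // q; rewrite peval_zcoord; apply: tofrac_neq0.
Qed.

Lemma horner_neq0 q a : q.[a] != 0 -> q != 0.
Proof. by apply: contraNneq => ->; rewrite horner0. Qed.

Lemma regatD x f g : regat x f -> regat x g -> regat x (f + g).
Proof.
have [t [a [tP xP]]] := regatP x; rewrite !xP.
move=> [p [q [q0 ->]]] [p' [q' [q0' ->]]].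
exists (p * q' + p' * q), (q * q'); rewrite hornerM mulf_neq0 //; split=> //.
by rewrite addf_div ?tP ?(horner_neq0 q0) ?(horner_neq0 q0') // pevalD !pevalM.
Qed.

Lemma regatM x f g : regat x f -> regat x g -> regat x (f * g).
Proof.
have [t [a [tP xP]]] := regatP x; rewrite !xP.
move=> [p [q [q0 ->]]] [p' [q' [q0' ->]]].
exists (p * p'), (q * q'); rewrite hornerM mulf_neq0 //; split=> //.
by rewrite mulf_div !pevalM.
Qed.

Lemma regat_scalar x c : regat x (Defs.scalar c).
Proof.
have [t [a [tP xP]]] := regatP x; rewrite xP.
exists c%:P, 1; rewrite hornerC oner_neq0; split=> //.
by rewrite -polyC1 !pevalC rmorph1 divr1.
Qed.

Lemma regat0 x : regat x 0.
Proof. by rewrite -[0](rmorph0 (@Defs.scalar C)); apply: regat_scalar. Qed.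
Lemma regat1 x : regat x 1.
Proof. by rewrite -[1](rmorph1 (@Defs.scalar C)); apply: regat_scalar. Qed.

Lemma regatN x f : regat x f -> regat x (- f).
Proof.
move=> xf; rewrite -mulN1r -[-1](rmorphN1 (@Defs.scalar C)).
by apply: regatM => //; apply: regat_scalar.
Qed.

Lemma regatB x f g : regat x f -> regat x g -> regat x (f - g).
Proof. by move=> xf xg; apply: regatD => //; apply: regatN. Qed.

Lemma regatX x f n : regat x f -> regat x (f ^+ n).
Proof.
move=> xf; elim: n => [|n IHn]; first exact: regat1.
by rewrite exprS; apply: regatM.
Qed.

Lemma regat_sum x (I : Type) (r : seq I) (P : pred I) (F : I -> K) :
  (forall i, P i -> regat x (F i)) -> regat x (\sum_(i <- r | P i) F i).
Proof. by move=> xF; elim/big_ind: _ => //; [apply: regat0 | apply: regatD]. Qed.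

Lemma regat_sign x n : regat x ((-1) ^+ n).
Proof. by apply/regatX/regatN/regat1. Qed.

Lemma regat_affine a f : regat (Some a) f <->
  exists p q, q.[a] != 0 /\ f = tf p / tf q.
Proof.
by split=> -[p [q [q0 ->]]]; exists p, q; split; rewrite ?peval_zcoord.
Qed.

Lemma regat_tofrac a p : regat (Some a) (tf p).
Proof.
by apply/regat_affine; exists p, 1; rewrite hornerC oner_neq0 rmorph1 divr1.
Qed.

Lemma regat_tofracV a q : q.[a] != 0 -> regat (Some a) (tf q)^-1.
Proof. by move=> qa; apply/regat_affine; exists 1, q; rewrite rmorph1 mul1r. Qed.

(** Regularity at infinity is a condition on degrees. *)
Lemma regat_infty f : regat None f <->
  exists p q, [/\ q != 0, (size p <= size q)%N & f = tf p / tf q].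
Proof.
split=> [[p [q [q0 ->]]]|[p [q [q0 le_pq ->]]]].
- have q0' := horner_neq0 q0.
  have Nmax : (0 < maxn (size p) (size q))%N by rewrite leq_max !size_poly_gt0 q0' orbT.
  move: Nmax (leq_maxl (size p) (size q)) (leq_maxr (size p) (size q)).
  set n := maxn _ _ => n0 le_p le_q; rewrite (peval_wcoord le_p) (peval_wcoord le_q).
  rewrite -mulf_div divff ?expf_neq0 ?wcoord_neq0 // mulr1.
  have Qn : (\poly_(i < n) q`_(n.-1 - i))`_n.-1 != 0.
    by rewrite coef_poly prednK // leqnn subnn -horner_coef0.
  exists (\poly_(i < n) p`_(n.-1 - i)), (\poly_(i < n) q`_(n.-1 - i)); split=> //.
    by apply: contraNneq Qn => ->; rewrite coef0.
  apply: (leq_trans (size_poly _ _)).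
  have : (n.-1 < size (\poly_(i < n) q`_(n.-1 - i))%R)%N.
    by rewrite ltnNge; apply: contra Qn => /(nth_default 0) ->.
  by rewrite prednK.
- set n := size q; have n0 : (0 < n)%N by rewrite size_poly_gt0.
  pose r (s : {poly C}) : {poly C} := \poly_(i < n) s`_(n.-1 - i).
  have rE (s : {poly C}) : (size s <= n)%N -> tf s * w ^+ n.-1 = peval (r s) w.
    move=> le_s; rewrite (@peval_wcoord n) ?size_poly //; congr (tf _ * _).
    apply/polyP=> i; rewrite coef_poly; case: ltnP => [i_n|n_i]; last first.
      by rewrite nth_default // (leq_trans le_s).
    have i_n1 : (i <= n.-1)%N by rewrite -ltnS prednK.
    by rewrite coef_poly subKn // ifT // (leq_ltn_trans (leq_subr _ _)) // prednK.
  exists (r p), (r q); rewrite -!rE //; split; last first.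
    by rewrite -mulf_div divff ?mulr1 // expf_neq0 // wcoord_neq0.
  rewrite horner_coef0 coef_poly n0 subn0.
  by rewrite -/(lead_coef q) lead_coef_eq0.
Qed.

Lemma regat_wcoord : regat None w.
Proof.
apply/regat_infty; exists 1, 'X; rewrite polyX_eq0 size_poly1 size_polyX; split=> //.
by rewrite rmorph1 mul1r.
Qed.

Lemma tofrac_repr f : let r := repr f in
  (\d_r)%R != 0 /\ f = tf (\n_r)%R / tf (\d_r)%R.
Proof.
set r := repr f; have dr : \d_r != 0 := denom_ratioP r; split=> //.
apply: (mulIf (tofrac_neq0 dr)); rewrite divfK ?tofrac_neq0 //.
rewrite -[f]reprK -/r; unlock FracField.tofrac; rewrite -[LHS]FracField.pi_mul.
apply/eqmodP => /=; rewrite FracField.equivfE /FracField.mulf.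
by rewrite !numden_Ratio ?mulr1 ?oner_neq0 // mulrC.
Qed.

Lemma tofrac_fracP f : exists p q, q != 0 /\ f = tf p / tf q.
Proof. by have [] := tofrac_repr f; eexists; eexists; split; eassumption. Qed.

(** A rational function without poles on the affine line is a polynomial: by
    algebraic closure a nonconstant denominator has a root, and regularity at
    that root allows one to cancel it. *)
Lemma regat_affine_poly f : (forall a, regat (Some a) f) -> exists p, f = tf p.
Proof.
have [p [q [q0 ->]]] := tofrac_fracP f.
elim: {q}_.+1 {-2}q (ltnSn (size q)) p q0 => // n IHn q q_n p q0 pq.
have [/size_poly1P[c c0 ->]|] := boolP (size q == 1%N).
  exists (c^-1 *: p); rewrite -mul_polyC rmorphM /= mulrC; congr (_ * _).
  by rewrite -[LHS]/(_^-1) -[tf c%:P]/(Defs.scalar c) -fmorphV.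
move=> /closed_rootP[a]; have [p1 [q1 [q1a pq1]]] := proj1 (regat_affine a _) (pq a).
have /eqP := pq1; rewrite eqr_div ?tofrac_neq0 ?(horner_neq0 q1a) // -!rmorphM tofrac_eq.
move=> /eqP pqE qa; have /factor_theorem[q' q'E] := qa.
have /factor_theorem[p' p'E] : root p a.
  move/(congr1 (horner^~ a)): pqE; rewrite !hornerM (eqP qa) mulr0.
  by move/eqP; rewrite mulf_eq0 (negbTE q1a) orbF.
have X0 : 'X - a%:P != 0 :> {poly C} by rewrite polyXsubC_eq0.
have q'0 : q' != 0 by apply: contraNneq q0 => q'0; rewrite q'E q'0 mul0r.
have E : tf p / tf q = tf p' / tf q'.
  by rewrite p'E q'E !rmorphM /= -mulf_div divff ?mulr1 // tofrac_neq0.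
rewrite E; apply: IHn => // [|b]; last by rewrite -E.
by move: q_n; rewrite q'E size_Mmonic ?monicXsubC // size_XsubC addn2 /= ltnS.
Qed.

Lemma partial_fraction_id (F : fieldType) (u v q d p : F) :
  q != 0 -> d != 0 -> u * d + v * q = 1 ->
  p * v / d - p / (q * d) = - (p * u / q).
Proof.
move=> q0 d0 uv; have -> : p / (q * d) = (u * d + v * q) * p / (q * d).
  by rewrite uv mul1r.
by field; rewrite q0 d0.
Qed.

(** Partial fractions: with denominator (z - a)^n q, where q does not vanish at a, a
    Bezout relation between the two factors splits off the polar part at a. *)
Lemma principal_part f a :
  exists h, regat (Some a) (h - f) /\ forall b, b != a -> regat (Some b) h.
Proof.
have [p [q [q0 ->]]] := tofrac_fracP f.
have [n [q1 /implyP/(_ q0) q1a qE]] := multiplicity_XsubC q a.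
have X0 : 'X - a%:P != 0 :> {poly C} by rewrite polyXsubC_eq0.
have q10 : q1 != 0 by apply: contraNneq q0 => q10; rewrite qE q10 mul0r.
have /Bezout_eq1_coprimepP[[u v] /= uv1] : coprimep (('X - a%:P) ^+ n) q1.
  by apply: coprimep_expl; rewrite coprimep_sym coprimep_XsubC.
exists (tf (p * v) / tf (('X - a%:P) ^+ n)); split=> [|b ba]; last first.
  apply: regatM; first exact: regat_tofrac.
  by apply: regat_tofracV; rewrite horner_exp hornerXsubC expf_neq0 // subr_eq0.
have -> : tf (p * v) / tf (('X - a%:P) ^+ n) - tf p / tf q = - (tf (p * u) / tf q1).
  have : tf u * tf (('X - a%:P) ^+ n) + tf v * tf q1 = 1 by rewrite -!rmorphM -rmorphD uv1 rmorph1.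
  rewrite qE !rmorphM; apply: partial_fraction_id; first exact: tofrac_neq0.
  by apply/tofrac_neq0/expf_neq0.
apply: regatN; apply: regatM; [exact: regat_tofrac | apply: regat_tofracV].
by rewrite -rootE.
Qed.

(** Mittag-Leffler on the affine line: finitely many polar parts are realised
    by one rational function. *)
Lemma principal_parts (s : seq C) (f : C -> K) :
  exists h, forall a, if a \in s then regat (Some a) (h - f a) else regat (Some a) h.
Proof.
elim: s => [|b s [h hP]]; first by exists 0 => a; apply: regat0.
have [bs|bs] := boolP (b \in s).
  by exists h => a; rewrite inE; have [->|_] := eqVneq a b; [have := hP b; rewrite bs | apply: hP].
have [g [gb gP]] := principal_part (f b) b; exists (h + g) => a; rewrite inE.
have [->|ab] /= := eqVneq a b.
  by have := hP b; rewrite (negbTE bs) -addrA => hb; apply: regatD.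
have := hP a; case: (a \in s) => ha; last by apply: regatD => //; apply: gP.
by rewrite addrAC; apply: regatD => //; apply: gP.
Qed.

(** ** The cohomology of a line bundle *)

(** The condition that z^e w^2 f be regular at infinity defines the line bundle of
    degree 2 - e; its global sections are the polynomials of degree at most 2 - e. *)
Lemma regat_infty_poly e p :
  regat None (tf p * z ^+ e * w ^+ 2) <-> p = 0 \/ (size p + e <= 3)%N.
Proof.
have [->|p0] := eqVneq p 0.
  by rewrite rmorph0 !mul0r; split=> [_|_]; [left | apply: regat0].
have E : tf p * z ^+ e * w ^+ 2 = tf (p * 'X^e) / tf 'X^2.
  by rewrite rmorphM !rmorphXn exprVn.
have szE : size (p * 'X^e) = (size p + e)%N.
  by rewrite size_Mmonic ?monicXn // size_polyXn addnS.
have X20 : 'X^2 != 0 :> {poly C} by apply/monic_neq0/monicXn.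
rewrite E; split=> [/regat_infty[P [Q [Q0 le_PQ]]]|[p00|le3]].
- move/eqP; rewrite (eqr_div _ _ (tofrac_neq0 X20) (tofrac_neq0 Q0)).
  rewrite -!rmorphM tofrac_eq => /eqP PQ.
  have P0 : P != 0.
    apply: contraNneq p0 => P0; move/eqP: PQ.
    by rewrite P0 mul0r !mulf_eq0 (negbTE Q0) (negbTE (monic_neq0 (monicXn _ _))) !orbF.
  have szM (r : {poly C}) n : r != 0 -> size (r * 'X^n) = (size r + n)%N.
    by move=> r0; rewrite size_Mmonic ?monicXn // size_polyXn addnS.
  right; move/(congr1 (fun r : {poly C} => size r)): PQ.
  have pX0 : p * 'X^e != 0 by apply: mulf_neq0 => //; apply/monic_neq0/monicXn.
  rewrite (size_mul pX0 Q0) !szM // => PQ.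
  have Q1 : (0 < size Q)%N by rewrite size_poly_gt0.
  by move: PQ le_PQ Q1; move: (size p) (size P) (size Q) => a b c; lia.
- by rewrite p00 eqxx in p0.
- by apply/regat_infty; exists (p * 'X^e), 'X^2; rewrite monic_neq0 ?monicXn // szE size_polyXn.
Qed.

(** The value at infinity: the local ring there is C + w O. *)
Lemma regat_infty_value f :
  regat None f -> exists c, regat None ((f - Defs.scalar c) * z).
Proof.
move=> [p [q [q0 ->]]]; exists (p.[0] / q.[0]).
have q0' := peval_wcoord_neq0 (horner_neq0 q0).
have /factor_theorem[r rE] : root (p - (p.[0] / q.[0])%:P * q) 0.
  by rewrite rootE hornerD hornerN hornerM hornerC divfK // subrr.
rewrite subr0 in rE; exists r, q; split=> //.
have <- : peval (r * 'X) w * z = peval r w.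
  by rewrite pevalM pevalX -mulrA [w * z]mulrC mulzw mulr1.
rewrite -rE; set c := p.[0] / q.[0].
have -> : peval (p - c%:P * q) w = peval p w - Defs.scalar c * peval q w.
  by rewrite pevalD -mulNr -polyCN pevalM pevalC rmorphN mulNr.
by rewrite [RHS]mulrAC [in RHS]mulrBl (mulfK q0').
Qed.

(** The first n terms of the expansion at infinity of a function vanishing there. *)
Lemma regat_infty_expansion n f : regat None (f * z) ->
  exists c : nat -> C,
    regat None ((f - \sum_(j < n) Defs.scalar (c j) * w ^+ j.+1) * z ^+ n.+1).
Proof.
move=> fz; elim: n => [|n [c /regat_infty_value[d dP]]].
  by exists (fun=> 0); rewrite big_ord0 subr0 expr1.
exists (fun j => if j == n then d else c j); rewrite big_ord_recr /= eqxx.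
rewrite (eq_bigr (fun j : 'I_n => Defs.scalar (c j) * w ^+ j.+1)); last first.
  by move=> i _; rewrite (ltn_eqF (ltn_ord i)).
rewrite opprD addrA; move: (_ - \sum_(j < n) _) dP => g.
suff -> : (g * z ^+ n.+1 - Defs.scalar d) * z =
          (g - Defs.scalar d * w ^+ n.+1) * z ^+ n.+2 by [].
rewrite [z ^+ n.+2]exprSr mulrA; congr (_ * _); rewrite mulrBl -[_ * _ * z ^+ _]mulrA -exprMn.
by rewrite [w * z]mulrC mulzw expr1n mulr1.
Qed.

(** H^1 of the line bundle of degree 2 - e is spanned by the classes of
    w, ..., w^(e - 3): division with remainder makes the function vanish at
    infinity, and then its expansion there is truncated. *)
Lemma line_h1_span e f : exists (c : 'I_(e - 3) -> C) (p : {poly C}),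
  regat None ((f - tf p - \sum_j Defs.scalar (c j) * w ^+ j.+1) * z ^+ e * w ^+ 2).
Proof.
have [p [q [q0 fE]]] := tofrac_fracP f.
pose g := f - tf (p %/ q).
have gz : regat None (g * z).
  apply/regat_infty; exists ((p %% q) * 'X), q; split=> //.
    have := ltn_modpN0 p q0; have [->|r0] := eqVneq (p %% q) 0.
      by rewrite mul0r size_poly0.
    by rewrite size_mulX.
  have -> : tf (p %% q * 'X) = tf (p %% q) * z by rewrite rmorphM.
  rewrite mulrAC; congr (_ * _); apply: (mulIf (tofrac_neq0 q0)).
  rewrite divfK ?tofrac_neq0 // /g fE mulrBl divfK ?tofrac_neq0 //.
  by rewrite {1}[p](divp_eq p q) rmorphD rmorphM /= addrAC subrr add0r.
have [c cP] := regat_infty_expansion (e - 3) gz.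
exists (fun j => c j), (p %/ q); rewrite -/g; move: (_ - \sum_(j < _) _) cP => h hz.
have zw2 n : z ^+ n.+2 * w ^+ 2 = z ^+ n.
  by rewrite -addn2 exprD -mulrA -exprMn mulzw expr1n mulr1.
case: (leqP e 3) => [e3|e3]; last first.
  by rewrite -[X in z ^+ X](subnK (ltnW e3)) addn3 -mulrA zw2.
have -> : h * z ^+ e * w ^+ 2 = (h * z ^+ (e - 3).+1) * w ^+ (3 - e).
  rewrite (eqP e3) expr1 -!mulrA; congr (_ * _).
  case: (e) e3 => [|[|[|[|]]]] // _; rewrite ?expr1 //.
  - by rewrite expr0 mul1r [w ^+ (3 - 0)]exprS mulrA mulzw mul1r.
  - by rewrite -exprMn mulzw expr1n.
  - by rewrite exprS -mulrA -exprMn mulzw expr1n.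
by apply: regatM => //; apply/regatX/regat_wcoord.
Qed.

(** These classes are independent: the polynomial p would vanish at infinity, hence
    is 0, and z^(e - 3) times the remaining sum is again a polynomial vanishing at
    infinity. *)
Lemma line_h1_free e (c : 'I_(e - 3) -> C) p :
  regat None ((tf p + \sum_j Defs.scalar (c j) * w ^+ j.+1) * z ^+ e * w ^+ 2) ->
  forall j, c j = 0.
Proof.
case: (leqP e 3) => [e3|e3]; first by move=> _ j; have := ltn_ord j; rewrite [X in (_ < X)%N](eqP e3).
have zX n m : (m <= n)%N -> z ^+ n * w ^+ m = z ^+ (n - m).
  by move=> mn; rewrite -{1}(subnK mn) exprD -mulrA -exprMn mulzw expr1n mulr1.
set S := \sum_j _ => pS.
have S1 : regat None (S * z).
  rewrite /S mulr_suml; apply: regat_sum => j _.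
  rewrite exprSr -!mulrA [w * z]mulrC mulzw mulr1.
  by apply: regatM; [apply: regat_scalar | apply/regatX/regat_wcoord].
have p0 : p = 0.
  have : regat None (tf p * z).
    rewrite -[tf p](addrK S) mulrBl; apply: regatB => //.
    have -> : (tf p + S) * z = ((tf p + S) * z ^+ e * w ^+ 2) * w ^+ (e - 3).
      rewrite -[RHS]mulrA -exprD -[RHS]mulrA zX; last by lia.
      by congr (_ * _); rewrite (_ : (e - (2 + (e - 3)) = 1)%N) //; lia.
    by apply: regatM => //; apply/regatX/regat_wcoord.
  have -> : tf p * z = tf p * z ^+ 3 * w ^+ 2 by rewrite -mulrA zX.
  by move/regat_infty_poly => [//|]; rewrite -[X in (_ <= X)%N]add0n leq_add2r leqn0 size_poly_eq0 => /eqP.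
have : regat None (tf (\sum_j c j *: 'X^(rev_ord j)) * z ^+ 3 * w ^+ 2).
  suff -> : tf (\sum_j c j *: 'X^(rev_ord j)) * z ^+ 3 * w ^+ 2 =
            (tf p + S) * z ^+ e * w ^+ 2 by [].
  rewrite p0 rmorph0 add0r -[LHS]mulrA -[RHS]mulrA zX // zX; last by lia.
  rewrite rmorph_sum /S !mulr_suml; apply: eq_bigr => j _.
  have jn := ltn_ord j.
  rewrite -mul_polyC rmorphM rmorphXn /= -[LHS]mulrA -[RHS]mulrA; congr (_ * _).
  rewrite [RHS]mulrC zX; last by lia.
  by rewrite -[tf 'X]/z -exprD /=; congr (_ ^+ _); lia.
move/regat_infty_poly => le3 j; have P0 : \sum_j c j *: 'X^(rev_ord j) = 0.
  case: le3 => //; rewrite -[X in (_ <= X)%N]add0n leq_add2r leqn0 size_poly_eq0.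
  by move/eqP.
have := congr1 (fun P : {poly C} => P`_(rev_ord j)) P0.
rewrite coef0 coef_sum (bigD1 j) //= coefZ coefXn eqxx mulr1 big1 ?addr0 // => i ij.
have [in_ jn] := (ltn_ord i, ltn_ord j); rewrite coefZ coefXn.
case: eqP => [E|_]; last by rewrite mulr0.
by case/negP: ij; apply/eqP/val_inj => /=; lia.
Qed.

(** ** The derivation d/dz *)

Fact rder_key : unit. Proof. exact: tt. Qed.

(** The quotient rule on the chosen representative of a fraction.  The function is
    locked because its value at a variable is itself a quotient, which rewriting
    rules for products and quotients would otherwise enter. *)
Definition rder : K -> K := locked_with rder_key (fun f =>
  let p := \n_(repr f) in let q := \d_(repr f) in
  (tf p^`() * tf q - tf p * tf q^`()) / tf q ^+ 2).

Lemma quotient_rule_id (A : comNzRingType) (p q p1 q1 dp dq dp1 dq1 : A) :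
  p * q1 = p1 * q -> dp * q1 + p * dq1 = dp1 * q + p1 * dq ->
  (dp * q - p * dq) * q1 ^+ 2 = (dp1 * q1 - p1 * dq1) * q ^+ 2.
Proof.
move=> e de; apply/eqP; rewrite -subr_eq0; apply/eqP.
transitivity (q * q1 * ((dp * q1 + p * dq1) - (dp1 * q + p1 * dq))
  - (p * q1 - p1 * q) * (q * dq1 + dq * q1)); first by ring.
by rewrite e de !subrr mulr0 mul0r subrr.
Qed.

(** The quotient rule does not depend on the representative. *)
Lemma rderE p q : q != 0 ->
  rder (tf p / tf q) = (tf p^`() * tf q - tf p * tf q^`()) / tf q ^+ 2.
Proof.
move=> q0; rewrite [rder]unlock; cbv beta zeta.
case: (tofrac_repr (tf p / tf q)).
move: (\n__)%R (\d__)%R => p1 q1 q10 e.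
have q20 r : r != 0 -> tf r ^+ 2 != 0 by move=> r0; apply/expf_neq0/tofrac_neq0.
move: e => /esym/eqP; rewrite (eqr_div _ _ (tofrac_neq0 q10) (tofrac_neq0 q0)).
rewrite -!tofracM tofrac_eq => /eqP e.
apply/eqP; rewrite (eqr_div _ _ (q20 _ q10) (q20 _ q0)); apply/eqP.
rewrite -!tofracXn -!tofracB -!tofracM; congr (tf _).
by apply: quotient_rule_id => //; rewrite -!derivM e.
Qed.

Lemma rder_tofrac p : rder (tf p) = tf p^`().
Proof.
rewrite -[tf p]divr1 -(rmorph1 tf) rderE ?oner_neq0 // derivC rmorph0 mulr0.
by rewrite subr0 rmorph1 mulr1 expr1n divr1.
Qed.

Lemma quotient_ruleM (F : fieldType) (p q p1 q1 dp dq dp1 dq1 : F) :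
  q != 0 -> q1 != 0 ->
  ((dp * p1 + p * dp1) * (q * q1) - p * p1 * (dq * q1 + q * dq1)) / (q * q1) ^+ 2
  = (dp * q - p * dq) / q ^+ 2 * (p1 / q1) + p / q * ((dp1 * q1 - p1 * dq1) / q1 ^+ 2).
Proof. by move=> q0 q10; field; rewrite q0 q10. Qed.

Lemma quotient_ruleD (F : fieldType) (p q p1 q1 dp dq dp1 dq1 : F) :
  q != 0 -> q1 != 0 ->
  ((dp * q1 + p * dq1 + (dp1 * q + p1 * dq)) * (q * q1)
    - (p * q1 + p1 * q) * (dq * q1 + q * dq1)) / (q * q1) ^+ 2
  = (dp * q - p * dq) / q ^+ 2 + (dp1 * q1 - p1 * dq1) / q1 ^+ 2.
Proof. by move=> q0 q10; field; rewrite q0 q10. Qed.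

Lemma rderM f g : rder (f * g) = rder f * g + f * rder g.
Proof.
have [p [q [q0 ->]]] := tofrac_fracP f; have [p1 [q1 [q10 ->]]] := tofrac_fracP g.
rewrite mulf_div -!rmorphM !rderE ?mulf_neq0 //.
rewrite !derivM !rmorphD !rmorphM.
by apply: quotient_ruleM; apply: tofrac_neq0.
Qed.

Lemma rderD f g : rder (f + g) = rder f + rder g.
Proof.
have [p [q [q0 ->]]] := tofrac_fracP f; have [p1 [q1 [q10 ->]]] := tofrac_fracP g.
rewrite (addf_div _ _ (tofrac_neq0 q0) (tofrac_neq0 q10)).
rewrite -!rmorphM -!rmorphD !rderE ?mulf_neq0 //.
rewrite !derivD !derivM !rmorphD !rmorphM.
by apply: quotient_ruleD; apply: tofrac_neq0.
Qed.

Lemma rder_scalar c : rder (Defs.scalar c) = 0.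
Proof. by rewrite -[Defs.scalar c]/(tf c%:P) rder_tofrac derivC rmorph0. Qed.

Lemma rderZ c f : rder (Defs.scalar c * f) = Defs.scalar c * rder f.
Proof. by rewrite rderM rder_scalar mul0r add0r. Qed.

Lemma rder_zcoord : rder z = 1.
Proof. by rewrite -[z]/(tf 'X) rder_tofrac derivX rmorph1. Qed.

Lemma rder_wcoord : rder w = - w ^+ 2.
Proof.
have := congr1 rder mulzw; rewrite rderM rder_zcoord mul1r.
have -> : rder 1 = 0 by rewrite -(rmorph1 (@Defs.scalar C)) rder_scalar.
move/eqP; rewrite addrC addr_eq0 => /eqP e; apply: (mulfI zcoord_neq0).
by rewrite e expr2 mulrN mulrA mulzw mul1r.
Qed.

Lemma rderX f n : rder (f ^+ n) = (f ^+ n.-1 * rder f) *+ n.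
Proof.
elim: n => [|n IHn].
  by rewrite expr0 mulr0n -(rmorph1 (@Defs.scalar C)) rder_scalar.
rewrite exprS rderM IHn mulrS mulrC; congr (_ + _).
by case: n {IHn} => [|n]; rewrite ?mulr0n ?mulr0 // mulrnAr mulrA -exprS.
Qed.

Lemma rder_peval p t : rder (peval p t) = peval p^`() t * rder t.
Proof.
elim/poly_ind: p => [|p c IHp].
  by rewrite deriv0 -polyC0 !pevalC rder_scalar rmorph0 mul0r.
rewrite derivD derivC addr0 derivM derivX mulr1 !pevalD !pevalM pevalC pevalX.
by rewrite rderD rder_scalar addr0 rderM IHp mulrDl mulrAC.
Qed.

(** The factor u with theta_i u = psi_i, where the psi_i are the odd coordinates of
    a chart around x. *)
Definition chart x : K := if x is Some _ then 1 else w.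

Lemma chart_neq0 x : chart x != 0.
Proof. by case: x => [a|]; [apply: oner_neq0 | apply: wcoord_neq0]. Qed.

(** Around x the derivation is u^2 times a regular one, as dw/dz = - w^2. *)
Lemma regat_rder x f : regat x f -> regat x (rder f * chart x ^- 2).
Proof.
move=> xf.
have [t [a [tP xP et]]] : exists t a, [/\ forall q, q != 0 -> peval q t != 0,
    forall f, regat x f <-> regular t a f & regat x (rder t * chart x ^- 2)].
  case: x {xf} => [a|].
    exists z, a; split=> //; first by move=> q q0; rewrite peval_zcoord tofrac_neq0.
    by rewrite rder_zcoord expr1n invr1 mulr1; apply: regat1.
  exists w, 0; split=> //; first exact: peval_wcoord_neq0.
  rewrite rder_wcoord mulNr divff; first exact/regatN/regat1.
  by apply/expf_neq0/wcoord_neq0.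
move/xP: xf => [p [q [qa fE]]]; have q0 := tP _ (horner_neq0 qa).
have lp r : regat x (peval r t).
  by apply/xP; exists r, 1; rewrite hornerC oner_neq0 -polyC1 pevalC rmorph1 divr1.
have lq : regat x (peval q t)^-1.
  by apply/xP; exists 1, q; split=> //; rewrite -polyC1 pevalC rmorph1 mul1r.
have -> : rder f = (peval p^`() t - f * peval q^`() t) / peval q t * rder t.
  have fq : f * peval q t = peval p t by rewrite fE divfK.
  have := congr1 rder fq; rewrite rderM !rder_peval => /(canRL (addrK _)) e.
  by apply: (mulIf q0); rewrite e mulrAC divfK // mulrBl mulrA.
rewrite -mulrA; apply: regatM => //; apply: regatM => //.
by apply: regatB => //; apply: regatM => //; apply/xP; exists p, q.
Qed.

End RationalFunctions.

Arguments regat : simpl never.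

(** * The superalgebra over the field of rational functions *)

Section SuperAlgebra.

Import mathcomp.boot.fintype mathcomp.boot.finset.

Variables (C : closedFieldType) (m : nat).
Local Notation K := (ratfun C).
Local Notation SF := (superfun C m).
Implicit Types (A B I J S X : {set 'I_m}) (a c k : K) (b : bool) (f g h F G : SF) (i : 'I_m).

Lemma inversionsE A B : inversions A B = (\sum_(i in A) \sum_(j in B) (j < i))%N.
Proof.
rewrite /inversions -sum1_card pair_big_dep /=.
rewrite (eq_bigl (fun ij : 'I_m * 'I_m =>
  [&& ij.1 \in A, ij.2 \in B & (ij.2 < ij.1)%N])); last first.
  by move=> ij; apply/idP/idP => [/set_mem //|?]; apply/mem_set.
rewrite big_mkcond [RHS]big_mkcond /=; apply: eq_bigr => -[i j] _ /=.
by case: (i \in A); case: (j \in B) => //=; case: (j < i)%N.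
Qed.

Lemma inversionsUl A B S : A :&: B = set0 ->
  inversions (A :|: B) S = (inversions A S + inversions B S)%N.
Proof.
move=> /eqP; rewrite setI_eq0 => AB; rewrite !inversionsE.
by rewrite (eq_bigl [predU A & B]) ?bigU // => i; rewrite !inE.
Qed.

Lemma inversionsUr A B S : A :&: B = set0 ->
  inversions S (A :|: B) = (inversions S A + inversions S B)%N.
Proof.
move=> /eqP; rewrite setI_eq0 => AB; rewrite !inversionsE -big_split /=.
apply: eq_bigr => i _.
by rewrite (eq_bigl [predU A & B]) ?bigU // => j; rewrite !inE.
Qed.

(** Each pair in A x B is an inversion in exactly one of the two orders. *)
Lemma inversions_swap A B : A :&: B = set0 ->
  (inversions A B + inversions B A = #|A| * #|B|)%N.
Proof.
move=> AB; rewrite !inversionsE [X in (_ + X)%N]exchange_big -big_split /=.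
rewrite -sum_nat_const; apply: eq_bigr => i iA.
rewrite -big_split /= -sum1_card; apply: eq_bigr => j jB.
case: ltngtP => // ij; have /setP/(_ i) := AB.
by rewrite !inE iA -(ord_inj ij) jB.
Qed.

Definition sgn A B : K := (-1) ^+ inversions A B.

Lemma sgnUl A B S : A :&: B = set0 -> sgn (A :|: B) S = sgn A S * sgn B S.
Proof. by move=> AB; rewrite /sgn inversionsUl // exprD. Qed.

Lemma sgnUr A B S : A :&: B = set0 -> sgn S (A :|: B) = sgn S A * sgn S B.
Proof. by move=> AB; rewrite /sgn inversionsUr // exprD. Qed.

Lemma sqr_sign n : (-1) ^+ n * (-1) ^+ n = 1 :> K.
Proof. by rewrite -exprMn mulrNN mulr1 expr1n. Qed.

Lemma sgnK A B : sgn A B * sgn A B = 1.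
Proof. exact: sqr_sign. Qed.

Lemma sgn_swap A B : A :&: B = set0 ->
  sgn B A = (-1) ^+ (#|A| * #|B|) * sgn A B.
Proof.
move=> AB; rewrite -(inversions_swap AB) exprD -/(sgn A B) -/(sgn B A).
by rewrite mulrAC sgnK mul1r.
Qed.

(** The monomial c theta_A. *)
Definition mono c A : SF := [ffun S => if S == A then c else 0].

Lemma mono0 A : mono 0 A = 0.
Proof. by apply/ffunP => S; rewrite !ffunE if_same. Qed.

Lemma monoD a c A : mono (a + c) A = mono a A + mono c A.
Proof. by apply/ffunP => S; rewrite !ffunE; case: eqP; rewrite ?addr0. Qed.

Lemma superfun_mono f : f = \sum_A mono (f A) A.
Proof.
apply/ffunP => S; rewrite sum_ffunE (bigD1 S) //= ffunE eqxx big1 ?addr0 // => A AS.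
by rewrite ffunE eq_sym (negbTE AS).
Qed.

(** An additive property holds everywhere once it holds on monomials. *)
Lemma superfun_ind (P : SF -> Prop) :
  (forall f g, P f -> P g -> P (f + g)) -> (forall c A, P (mono c A)) ->
  forall f, P f.
Proof.
move=> PD Pm f; rewrite (superfun_mono f); elim/big_ind: _ => //.
by rewrite -(mono0 set0).
Qed.

Lemma smulDl f g h : smul (f + g) h = smul f h + smul g h.
Proof.
apply/ffunP => S; rewrite !ffunE -big_split; apply: eq_bigr => A _ /=.
by rewrite !ffunE mulrDr mulrDl.
Qed.

Lemma smulDr f g h : smul h (f + g) = smul h f + smul h g.
Proof.
apply/ffunP => S; rewrite !ffunE -big_split; apply: eq_bigr => A _ /=.
by rewrite !ffunE mulrDr.
Qed.

Lemma smul0 f : smul f 0 = 0.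
Proof. by apply: (addIr (smul f 0)); rewrite -smulDr !add0r. Qed.

Lemma mul0s f : smul 0 f = 0.
Proof. by apply: (addIr (smul 0 f)); rewrite -smulDl !add0r. Qed.

Lemma smulNr f g : smul f (- g) = - smul f g.
Proof. by apply: (addIr (smul f g)); rewrite -smulDr !addNr smul0. Qed.

Lemma smulNl f g : smul (- f) g = - smul f g.
Proof. by apply: (addIr (smul f g)); rewrite -smulDl !addNr mul0s. Qed.

Lemma smulBl f g h : smul (f - g) h = smul f h - smul g h.
Proof. by rewrite smulDl smulNl. Qed.

Lemma smul_suml (T : Type) (r : seq T) (P : pred T) (E : T -> SF) f :
  smul (\sum_(t <- r | P t) E t) f = \sum_(t <- r | P t) smul (E t) f.
Proof.
apply: (big_ind2 (fun x y => smul x f = y)) => [|x y x' y' <- <-|//].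
  exact: mul0s.
exact: smulDl.
Qed.

Lemma smul_sumr (T : Type) (r : seq T) (P : pred T) (E : T -> SF) f :
  smul f (\sum_(t <- r | P t) E t) = \sum_(t <- r | P t) smul f (E t).
Proof.
apply: (big_ind2 (fun x y => smul f x = y)) => [|x y x' y' <- <-|//].
  exact: smul0.
exact: smulDr.
Qed.

Lemma smul_mono a c A B : smul (mono a A) (mono c B) =
  if A :&: B == set0 then mono (sgn A B * a * c) (A :|: B) else 0.
Proof.
have E S X : X \subset S -> (S :\: X == B) = (S == X :|: B) && (X :&: B == set0).
  move=> XS; apply/eqP/andP => [<-|[/eqP-> /eqP XB]].
    split; apply/eqP/setP => x; rewrite !inE; last by case: (x \in X).
    by case xX : (x \in X) => //=; rewrite (subsetP XS _ xX).
  by rewrite setDUl setDv set0U; apply/setDidPl; rewrite -setI_eq0 setIC XB.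
apply/ffunP => S; rewrite ffunE.
have [AS|AS] := boolP (A \subset S); last first.
  rewrite big1 => [|X XS]; last first.
    rewrite !ffunE; case: (X =P A) => [XA|_]; last by rewrite mulr0 mul0r.
    by rewrite -XA XS in AS.
  case: ifP => _; rewrite !ffunE //.
  by case: eqP => // SE; rewrite SE subsetUl in AS.
rewrite (bigD1 A) //= big1 ?addr0 => [|X /andP[XS XA]]; last first.
  by rewrite !ffunE (negbTE XA) mulr0 mul0r.
rewrite !ffunE eqxx E //; have [AB|AB] := boolP (A :&: B == set0); last first.
  by rewrite andbF mulr0 ffunE.
rewrite andbT ffunE; case: eqP => [SE|_]; last by rewrite mulr0.
suff -> : S :\: A = B by [].
by apply/eqP; rewrite E // SE eqxx AB.
Qed.

Lemma setUI_eq0 A B S : ((A :|: B) :&: S == set0) = (A :&: S == set0) && (B :&: S == set0).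
Proof. by rewrite setIUl setU_eq0. Qed.

Lemma setIU_eq0 A B S : (S :&: (A :|: B) == set0) = (S :&: A == set0) && (S :&: B == set0).
Proof. by rewrite setIUr setU_eq0. Qed.

Lemma smulA_sign (R : comNzRingType) (s t u x y v : R) :
  s * t * x * (u * y * v) = t * u * (s * x * y) * v.
Proof. by ring. Qed.

Lemma smulA f g h : smul f (smul g h) = smul (smul f g) h.
Proof.
elim/superfun_ind: f => [f f' IH IH'|a A]; first by rewrite !smulDl IH IH'.
elim/superfun_ind: g => [g g' IH IH'|b B].
  by rewrite smulDl !smulDr smulDl IH IH'.
elim/superfun_ind: h => [h h' IH IH'|c S]; first by rewrite !smulDr IH IH'.
rewrite (smul_mono b c) (smul_mono a b).
case: ifP => BS; case: ifP => AB;
  rewrite ?smul0 ?mul0s ?smul_mono ?setUI_eq0 ?setIU_eq0 ?AB ?BS ?andbF //=.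
rewrite andbT; case: ifP => // _; move/eqP: BS => BS; move/eqP: AB => AB.
rewrite setUA sgnUl // sgnUr //; congr (mono _ _).
by move: (sgn A B) (sgn A S) (sgn B S) a b c; apply: smulA_sign.
Qed.

Lemma smul1 f : smul f (mono 1 set0) = f.
Proof.
elim/superfun_ind: f => [f g IH IH'|a A]; first by rewrite smulDl IH IH'.
rewrite smul_mono setI0 eqxx setU0 mulr1 /sgn inversionsE.
by rewrite big1 ?mul1r // => i _; rewrite big_set0.
Qed.

(** Multiplication by an even function k, that is, by k theta_A with A empty. *)
Definition kscale k f : SF := [ffun I => k * f I].

Lemma smul_scalel k f : smul (mono k set0) f = kscale k f.
Proof.
apply/ffunP => S; rewrite !ffunE (bigD1 set0) ?sub0set //= big1 ?addr0 => [|A /andP[_ A0]].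
  by rewrite ffunE eqxx setD0 /sgn inversionsE big_set0 mul1r.
by rewrite ffunE (negbTE A0) mulr0 mul0r.
Qed.

Lemma kscaleD k f g : kscale k (f + g) = kscale k f + kscale k g.
Proof. by apply/ffunP => S; rewrite !ffunE mulrDr. Qed.

Lemma kscale_mono k a A : kscale k (mono a A) = mono (k * a) A.
Proof. by apply/ffunP => S; rewrite !ffunE; case: eqP => // _; rewrite mulr0. Qed.

Lemma kscaleA k a f : kscale k (kscale a f) = kscale (k * a) f.
Proof. by apply/ffunP => S; rewrite !ffunE mulrA. Qed.

Lemma kscale1 f : kscale 1 f = f.
Proof. by apply/ffunP => S; rewrite !ffunE mul1r. Qed.

Lemma smulZl k f g : smul (kscale k f) g = kscale k (smul f g).
Proof. by rewrite -!smul_scalel smulA. Qed.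

Lemma smulZr k f g : smul f (kscale k g) = kscale k (smul f g).
Proof.
apply/ffunP => S; rewrite !ffunE mulr_sumr; apply: eq_bigr => A _.
by rewrite !ffunE mulrCA.
Qed.

Lemma sscaleE (c : C) f : sscale c f = kscale (Defs.scalar c) f.
Proof. by []. Qed.

(** ** Parity *)

(** f with the sign that an element of parity b picks up in moving past it. *)
Definition twist (b : bool) f : SF := [ffun I : {set 'I_m} => (-1) ^+ (b * #|I|) * f I].

Lemma twistD b f g : twist b (f + g) = twist b f + twist b g.
Proof. by apply/ffunP => S; rewrite !ffunE mulrDr. Qed.

Lemma twist_mono b a A : twist b (mono a A) = mono ((-1) ^+ (b * #|A|) * a) A.
Proof. by apply/ffunP => S; rewrite !ffunE; case: eqP => [->//|_]; rewrite mulr0. Qed.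

Lemma twist_twist b b' f : twist b (twist b' f) = twist (b (+) b') f.
Proof.
apply/ffunP => S; rewrite !ffunE mulrA; congr (_ * _).
by case: b b' => -[] /=; rewrite ?mul0n ?mul1r ?mulr1 // sqr_sign.
Qed.

Lemma twist_homog b b' f : homog b' f -> twist b f = if b && b' then - f else f.
Proof.
move=> hf; apply/ffunP => S; rewrite ffunE.
have [/eqP e|/hf fS] := boolP (odd #|S| == b'); last first.
  by rewrite fS mulr0; case: ifP => _; rewrite ?ffunE fS ?oppr0.
rewrite -signr_odd oddM e oddb.
by case: (b && b'); rewrite ?ffunE ?mul1r // expr1 mulN1r.
Qed.

Lemma mono_comm a A f : smul (mono a A) f = smul (twist (odd #|A|) f) (mono a A).
Proof.
elim/superfun_ind: f => [f g IH IH'|b B]; first by rewrite twistD smulDr smulDl IH IH'.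
rewrite twist_mono !smul_mono setIC setUC; case: eqP => // BA.
rewrite (sgn_swap BA); congr (mono _ _).
rewrite -[(-1) ^+ (odd _ * _)]signr_odd oddM oddb -oddM signr_odd [(#|A| * _)%N]mulnC.
by move: ((-1) ^+ _) (sgn B A) => s t; rewrite -!mulrA [a * b]mulrC mulrCA [s * (b * a)]mulrA.
Qed.

(** Supercommutativity; the twist makes the sign rule linear in f. *)
Lemma smul_comm b f g : homog b g -> smul g f = smul (twist b f) g.
Proof.
move=> hg; rewrite (superfun_mono g) smul_suml smul_sumr; apply: eq_bigr => A _.
have [/eqP <-|/hg ->] := boolP (odd #|A| == b); first exact: mono_comm.
by rewrite mono0 mul0s smul0.
Qed.

Lemma homogD b f g : homog b f -> homog b g -> homog b (f + g).
Proof. by move=> hf hg I Ib; rewrite ffunE hf // hg // addr0. Qed.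

Lemma homogN b f : homog b f -> homog b (- f).
Proof. by move=> hf I Ib; rewrite ffunE hf // oppr0. Qed.

Lemma homog0 b : homog b (0 : SF).
Proof. by move=> I _; rewrite ffunE. Qed.

Lemma homog_mono a A : homog (odd #|A|) (mono a A).
Proof.
by move=> I; rewrite ffunE; case: (I =P A) => // -> /eqP.
Qed.

Lemma homog_smul b b' f g : homog b f -> homog b' g -> homog (b (+) b') (smul f g).
Proof.
move=> hf hg S Sb; rewrite ffunE big1 // => A AS.
have [e|/hf ->] := boolP (odd #|A| == b); last by rewrite mulr0 mul0r.
rewrite hg ?mulr0 //; apply: contraNneq Sb => <-.
by rewrite -(eqP e) -oddD -(cardsID A S) (setIidPr AS).
Qed.

(** The part of parity b. *)
Definition hpart (b : bool) f : SF := [ffun I : {set 'I_m} => if odd #|I| == b then f I else 0].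

Lemma homog_hpart b f : homog b (hpart b f).
Proof. by move=> I /negbTE Ib; rewrite ffunE Ib. Qed.

Lemma hpart_split f : f = hpart false f + hpart true f.
Proof. by apply/ffunP => I; rewrite !ffunE; case: odd; rewrite ?add0r ?addr0. Qed.

Lemma hpart_homogD b f g : homog b f -> homog (~~ b) g -> hpart b (f + g) = f.
Proof.
move=> hf hg; apply/ffunP => I; rewrite !ffunE.
have [/eqP e|/hf -> //] := boolP (odd #|I| == b).
by rewrite hg ?addr0 // e; case: (b).
Qed.

(** ** The derivations d/dz and d/dtheta_i *)

Definition dz f : SF := [ffun I => rder (f I)].

(** The left derivative: theta_i theta_I goes to theta_I for i outside I. *)
Definition dtheta i f : SF :=
  [ffun I : {set 'I_m} => if i \in I then 0 else sgn [set i] I * f (i |: I)].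

Lemma dzD f g : dz (f + g) = dz f + dz g.
Proof. by apply/ffunP => I; rewrite !ffunE rderD. Qed.

Lemma dz_mono a A : dz (mono a A) = mono (rder a) A.
Proof.
apply/ffunP => I; rewrite !ffunE; case: eqP => // _.
by rewrite -(rmorph0 (@Defs.scalar C)) rder_scalar rmorph0.
Qed.

Lemma rder_sign n a : rder ((-1) ^+ n * a) = (-1) ^+ n * rder a.
Proof.
have -> : (-1) ^+ n = Defs.scalar ((-1) ^+ n) :> K by rewrite rmorph_sign.
exact: rderZ.
Qed.

Lemma dz_smul f g : dz (smul f g) = smul (dz f) g + smul f (dz g).
Proof.
elim/superfun_ind: f => [f f' IH IH'|a A].
  by rewrite dzD !smulDl dzD IH IH' addrACA.
elim/superfun_ind: g => [g g' IH IH'|b B].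
  by rewrite dzD !smulDr dzD IH IH' addrACA.
rewrite !dz_mono !smul_mono; case: ifP => _; last first.
  by apply/ffunP => I; rewrite !ffunE -(rmorph0 (@Defs.scalar C)) rder_scalar rmorph0 addr0.
by rewrite dz_mono -monoD /sgn -!mulrA rder_sign rderM mulrDr.
Qed.

Lemma homog_dz b f : homog b f -> homog b (dz f).
Proof.
move=> hf I Ib; rewrite ffunE hf //.
by rewrite -(rmorph0 (@Defs.scalar C)) rder_scalar rmorph0.
Qed.

Lemma dz_scale (c : C) f : dz (sscale c f) = sscale c (dz f).
Proof. by apply/ffunP => I; rewrite !ffunE rderZ. Qed.

Lemma dthetaD i f g : dtheta i (f + g) = dtheta i f + dtheta i g.
Proof. by apply/ffunP => I; rewrite !ffunE; case: ifP; rewrite ?addr0 // mulrDr. Qed.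

Lemma dtheta_scale i k f : dtheta i (kscale k f) = kscale k (dtheta i f).
Proof. by apply/ffunP => I; rewrite !ffunE; case: ifP; rewrite ?mulr0 // mulrCA. Qed.

Lemma dtheta0 i : dtheta i 0 = 0.
Proof. by apply/ffunP => I; rewrite !ffunE mulr0 if_same. Qed.

Lemma homog_dtheta i b f : homog b f -> homog (~~ b) (dtheta i f).
Proof.
move=> hf I Ib; rewrite ffunE; case: ifP => // iI; rewrite hf ?mulr0 //.
by rewrite cardsU1 iI add1n /=; move: b Ib {hf}; case: odd => -[].
Qed.

Lemma dtheta_mono i a A : dtheta i (mono a A) =
  if i \in A then mono (sgn [set i] (A :\ i) * a) (A :\ i) else 0.
Proof.
apply/ffunP => I; rewrite ffunE; case: ifP => iI.
  case: ifP => iA; rewrite ffunE //; case: eqP => // IA.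
  by rewrite IA !inE eqxx in iI.
rewrite ffunE; have [<-|IA] := eqVneq (i |: I) A.
  by rewrite !inE eqxx /= setU1K ?iI // ffunE eqxx.
rewrite mulr0; case: ifP => iA; rewrite ffunE //; case: eqP => // IE.
by rewrite IE setD1K // eqxx in IA.
Qed.

Lemma set1U_split i A : i \in A -> exists2 A' : {set 'I_m}, i \notin A' & A = i |: A'.
Proof. by move=> iA; exists (A :\ i); rewrite ?setD1K // !inE eqxx. Qed.

Lemma set1I_notin i A : i \notin A -> [set i] :&: A = set0.
Proof.
by move=> iA; apply/setP => j; rewrite !inE; case: eqP => // ->; rewrite (negbTE iA).
Qed.

Lemma sgn_swap1 i A : i \notin A -> sgn [set i] A * sgn A [set i] = (-1) ^+ #|A|.
Proof.
move=> iA; rewrite (sgn_swap (set1I_notin iA)) cards1 mul1n mulrCA sgnK mulr1.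
by [].
Qed.

Lemma dtheta_sign_left (R : comNzRingType) (s t u x y : R) :
  s * s = 1 -> t * s * (s * u * x * y) = u * (t * x) * y.
Proof. by move=> ss; rewrite -[RHS]mul1r -ss; ring. Qed.

Lemma dtheta_sign_right (R : comNzRingType) (s t u v x y : R) :
  s * t * (u * v * x * y) = v * (s * u * x) * (t * y).
Proof. by ring. Qed.

Lemma dtheta_sign_both (R : comNzRingType) (s t u v x y : R) :
  t * u * (s * x) * y + v * u * (- 1 * (s * t) * x) * (v * y) = (1 - v * v) * (s * t * u * x * y).
Proof. by ring. Qed.

(** The odd Leibniz rule, on monomials.  If i belongs to both factors, the left-hand
    side is 0 and the two terms on the right cancel. *)
Lemma dtheta_smul i f g :
  dtheta i (smul f g) = smul (dtheta i f) g + smul (twist true f) (dtheta i g).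
Proof.
elim/superfun_ind: f => [f f' IH IH'|a A].
  by rewrite twistD dthetaD !smulDl dthetaD IH IH' addrACA.
elim/superfun_ind: g => [g g' IH IH'|b B].
  by rewrite dthetaD !smulDr dthetaD IH IH' addrACA.
rewrite twist_mono mul1n !dtheta_mono smul_mono.
have [iA|iA] := boolP (i \in A); have [iB|iB] := boolP (i \in B);
  rewrite ?smul0 ?mul0s ?add0r ?addr0.
- have AB : A :&: B != set0 by apply/set0Pn; exists i; rewrite inE iA.
  rewrite (negbTE AB) dtheta0; move: AB => _.
  have [A' iA' AE] := set1U_split iA; have [B' iB' BE] := set1U_split iB.
  have iA0 := set1I_notin iA'; have iB0 := set1I_notin iB'.
  rewrite AE BE !setU1K // !smul_mono setUI_eq0 setIU_eq0 iB0 eqxx setIC iA0 eqxx /=.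
  case: ifP => [/eqP AB|_]; last by rewrite addr0.
  rewrite setUCA setUA -monoD sgnUr // sgnUl // cardsU1 iA' exprD expr1.
  by rewrite -(sgn_swap1 iA') dtheta_sign_both sgnK subrr mul0r mono0.
- have [A' iA' AE] := set1U_split iA; have iA0 := set1I_notin iA'; have iB0 := set1I_notin iB.
  rewrite AE !setU1K // smul_mono setUI_eq0 iB0 eqxx /=; case: ifP => AB; last first.
    by rewrite dtheta0.
  rewrite -setUA dtheta_mono !inE eqxx /= setU1K ?inE ?negb_or ?iA' //.
  rewrite sgnUl // sgnUr; last exact/eqP.
  congr (mono _ _); move: (sgnK [set i] B); apply: dtheta_sign_left.
- have [B' iB' BE] := set1U_split iB; have iA0 := set1I_notin iA; have iB0 := set1I_notin iB'.
  rewrite BE !setU1K // smul_mono setIU_eq0 setIC iA0 eqxx /=; case: ifP => AB; last first.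
    by rewrite dtheta0.
  rewrite setUCA dtheta_mono !inE eqxx /= setU1K ?inE ?negb_or ?iA //.
  rewrite -(sgn_swap1 iA) [sgn A (i |: B')]sgnUr // sgnUr; last exact/eqP.
  by congr (mono _ _); apply: dtheta_sign_right.
- by case: ifP => _; rewrite ?dtheta0 // dtheta_mono inE (negbTE iA) (negbTE iB).
Qed.

End SuperAlgebra.

(** * Superderivations *)

Section Superderivations.

Import mathcomp.boot.fintype mathcomp.boot.finset.

Variables (C : closedFieldType) (m : nat).
Local Notation K := (ratfun C).
Local Notation SF := (superfun C m).
Local Notation z := (zcoord C).
Local Notation w := (wcoord C).
Implicit Types (A B I J S : {set 'I_m}) (a c k : K) (b : bool) (f g h F G : SF) (i : 'I_m).
Implicit Types (D : SF -> SF) (x : P1 C).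

(** Families (f, g_1, ..., g_m), with f at None and g_i at Some i. *)
Definition coefs := {ffun option 'I_m -> SF}.
Implicit Types (v : coefs).

(** f d/dz + g_1 d/dtheta_1 + ... + g_m d/dtheta_m *)
Definition vfield v F : SF :=
  smul (v None) (dz F) + \sum_i smul (v (Some i)) (dtheta i F).

Lemma vfieldD v v' F : vfield (v + v') F = vfield v F + vfield v' F.
Proof.
rewrite /vfield ffunE smulDl addrACA -big_split; congr (_ + _).
by apply: eq_bigr => i _; rewrite ffunE smulDl.
Qed.

Lemma vfieldZ (c : C) v F :
  vfield [ffun o => sscale c (v o)] F = sscale c (vfield v F).
Proof.
rewrite /vfield ffunE sscaleE smulZl [RHS]sscaleE kscaleD; congr (_ + _).
rewrite -smul_scalel smul_sumr; apply: eq_bigr => i _.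
by rewrite ffunE sscaleE smulZl smul_scalel.
Qed.

Lemma vfield_add v F G : vfield v (F + G) = vfield v F + vfield v G.
Proof.
rewrite /vfield dzD smulDr addrACA -big_split; congr (_ + _).
by apply: eq_bigr => i _; rewrite dthetaD smulDr.
Qed.

Lemma vfield_scale v (c : C) F : vfield v (sscale c F) = sscale c (vfield v F).
Proof.
rewrite /vfield dz_scale [sscale c (_ + _)]sscaleE kscaleD sscaleE smulZr; congr (_ + _).
rewrite -smul_scalel smul_sumr; apply: eq_bigr => i _.
by rewrite sscaleE dtheta_scale smulZr smul_scalel.
Qed.

(** A vector field with homogeneous coefficients obeys the sign rule, because
    moving a homogeneous coefficient past F costs the twist of F. *)
Lemma vfield_homog b v : homog b (v None) ->
  (forall i, homog (~~ b) (v (Some i))) -> homog_superder b (vfield v).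
Proof.
move=> hf hg; split=> [c F G|b' F hF|b' F G hF].
- by rewrite vfield_add vfield_scale.
- apply: homogD; first by apply: homog_smul => //; apply: homog_dz.
  elim/big_ind: _ => [||i _]; [exact: homog0 | exact: homogD | ].
  have -> : b (+) b' = ~~ b (+) ~~ b' by case: (b); case: (b').
  by apply: homog_smul => //; apply: homog_dtheta.
- have -> : (if b && b' then - smul F (vfield v G) else smul F (vfield v G)) =
            smul (twist b F) (vfield v G).
    by rewrite (twist_homog _ hF); case: ifP => _; rewrite ?smulNl.
  rewrite /vfield dz_smul !smulDr smulDl !smulA -(smul_comm _ hf) -!addrA; congr (_ + _).
  rewrite addrCA; congr (_ + _); rewrite smul_suml smul_sumr -big_split; apply: eq_bigr => i _.
  rewrite dtheta_smul smulDr !smulA; congr (_ + smul _ _).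
  by rewrite (smul_comm _ (hg i)) twist_twist; case: (b).
Qed.

Lemma vfield_superder v : superder (vfield v).
Proof.
pose vb b : coefs := [ffun o => if o is Some i then hpart (~~ b) (v (Some i)) else hpart b (v None)].
exists (vfield (vb false)), (vfield (vb true)).
have vbP b : homog_superder b (vfield (vb b)).
  by apply: vfield_homog => [|i]; rewrite ffunE; apply: homog_hpart.
split=> // F; rewrite -vfieldD; congr (vfield _ F).
by apply/ffunP => -[i|]; rewrite !ffunE [LHS]hpart_split // addrC.
Qed.

Definition zfun : SF := mono z set0.
Definition theta i : SF := mono 1 [set i].

Lemma sgn0r A : sgn C A set0 = 1.
Proof. by rewrite /sgn inversionsE big1 // => i _; rewrite big_set0. Qed.

Lemma smul_scaler k f : smul f (mono k set0) = kscale k f.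
Proof. by rewrite -[k]mulr1 -kscale_mono smulZr smul1 mulr1. Qed.

Lemma rder1 : rder 1 = 0 :> K.
Proof. by rewrite -(rmorph1 (@Defs.scalar C)) rder_scalar. Qed.

Lemma vfield_even v k : vfield v (mono k set0) = kscale (rder k) (v None).
Proof.
rewrite /vfield dz_mono big1 ?addr0 => [|i _].
  by rewrite smul_scaler.
by rewrite dtheta_mono inE smul0.
Qed.

Lemma vfield_odd v k i : vfield v (mono k [set i]) =
  kscale k (v (Some i)) + kscale (rder k) (smul (v None) (theta i)).
Proof.
rewrite /vfield dz_mono (bigD1 i) //= big1 ?addr0 => [|j ji]; last first.
  by rewrite dtheta_mono inE (negbTE ji) smul0.
rewrite dtheta_mono inE eqxx addrC; congr (_ + _); last first.
  by rewrite -smulZr kscale_mono mulr1.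
by rewrite setDv sgn0r mul1r smul_scaler.
Qed.

Lemma vfield_zfun v : vfield v zfun = v None.
Proof. by rewrite vfield_even rder_zcoord kscale1. Qed.

Lemma vfield_theta v i : vfield v (theta i) = v (Some i).
Proof.
rewrite vfield_odd kscale1 rder1; apply/ffunP => S.
by rewrite !ffunE mul0r addr0.
Qed.

Lemma homog_superderB b D D' : homog_superder b D -> homog_superder b D' ->
  homog_superder b (fun F => D F - D' F).
Proof.
move=> [lD hD LD] [lD' hD' LD']; split=> [c F G|b' F hF|b' F G hF].
- rewrite lD lD' opprD addrACA; congr (_ + _).
  by apply/ffunP => I; rewrite !ffunE mulrBr.
- by apply: homogD; [apply: hD | apply/homogN/hD'].
- rewrite (LD b') // (LD' b') // smulBl opprD addrACA; congr (_ + _).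
  by case: ifP => _; rewrite smulDr smulNr // opprD.
Qed.

(** A superderivation is determined by its values on the coordinates: the
    Leibniz rule spreads these to polynomials in z, then to their quotients and
    to the products of the theta_i. *)
Lemma superder_rigid b D : homog_superder b D -> D zfun = 0 ->
  (forall i, D (theta i) = 0) -> forall F, D F = 0.
Proof.
move=> [linD hD LD] Dz Dth.
have sscale1 f : sscale 1 f = f by rewrite sscaleE rmorph1 kscale1.
have DD f g : D (f + g) = D f + D g by rewrite -{1}[f]sscale1 linD sscale1.
have Dzero : D 0 = 0 by apply: (addIr (D 0)); rewrite -DD !add0r.
have DZ (c : C) f : D (sscale c f) = sscale c (D f) by rewrite -[sscale c f]addr0 linD Dzero addr0.
have even0 k : homog false (mono k set0 : SF).
  by have := @homog_mono C m k set0; rewrite cards0.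
have Leven k f : D (smul (mono k set0) f) = smul (D (mono k set0)) f + kscale k (D f).
  by rewrite (LD false) ?andbF ?smul_scalel.
have D1 : D (mono 1 set0) = 0.
  have := Leven 1 (mono 1 set0); rewrite smul1 smul1 kscale1.
  by move/(canLR (addrK _)); rewrite subrr => <-.
have Dpoly p : D (mono (tofrac p) set0) = 0.
  elim/poly_ind: p => [|p c IHp]; first by rewrite rmorph0 mono0 Dzero.
  rewrite rmorphD rmorphM monoD DD /=.
  have -> : mono (tofrac c%:P) set0 = sscale c (mono 1 set0) :> SF.
    by rewrite sscaleE kscale_mono mulr1.
  have -> : mono (tofrac p * tofrac 'X) set0 = smul (mono (tofrac p) set0) zfun.
    by rewrite smul_scalel kscale_mono.
  rewrite DZ D1 Leven IHp Dz mul0s.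
  by apply/ffunP => S; rewrite !ffunE !mulr0 !addr0.
have Dfun k : D (mono k set0) = 0.
  have [p [q [q0 ->]]] := tofrac_fracP k.
  have := Leven (tofrac q) (mono (tofrac p / tofrac q) set0).
  rewrite smul_scalel kscale_mono mulrC divfK ?tofrac_neq0 // !Dpoly mul0s add0r.
  move/(congr1 (kscale (tofrac q)^-1)); rewrite kscaleA mulVf ?tofrac_neq0 // kscale1 => <-.
  by apply/ffunP => S; rewrite !ffunE mulr0.
have Dtheta A : D (mono 1 A) = 0.
  elim: {A}_.+1 {-2}A (ltnSn #|A|) => // n IHn A.
  have [->|[i iA]] := set_0Vmem A; first by rewrite D1.
  have [A' iA' ->] := set1U_split iA; rewrite cardsU1 iA' add1n ltnS => A'n.
  have <- : sscale ((-1) ^+ inversions [set i] A') (smul (theta i) (mono 1 A')) =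
            mono 1 (i |: A').
    rewrite smul_mono set1I_notin // eqxx sscaleE kscale_mono rmorph_sign !mulr1.
    by rewrite sgnK.
  have hth : homog true (theta i) by have := @homog_mono C m 1 [set i]; rewrite cards1.
  rewrite DZ (LD true) // Dth IHn // mul0s smul0 oppr0 if_same addr0.
  by apply/ffunP => S; rewrite !ffunE mulr0.
elim/superfun_ind => [f g Df Dg|k A]; first by rewrite DD Df Dg addr0.
rewrite -[k]mulr1 -kscale_mono -smul_scalel Leven Dfun Dtheta mul0s add0r.
by apply/ffunP => S; rewrite !ffunE mulr0.
Qed.

(** The even and the odd component of D each agree with a vector field on the
    coordinates, hence everywhere. *)
Lemma superder_vfield D : superder D -> exists v, D = vfield v.
Proof.
move=> [D0 [D1 [hD0 hD1 DE]]].
pose v b : coefs := [ffun o => if o is Some i then hpart (~~ b) (D (theta i)) else hpart b (D zfun)].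
have hz : homog false zfun by have := @homog_mono C m z set0; rewrite cards0.
have hth i : homog true (theta i) by have := @homog_mono C m 1 [set i]; rewrite cards1.
have vP b Db : homog_superder b Db -> Db zfun = hpart b (D zfun) ->
    (forall i, Db (theta i) = hpart (~~ b) (D (theta i))) -> forall F, Db F = vfield (v b) F.
  move=> hDb Dz Dth F; apply/eqP; rewrite -subr_eq0; apply/eqP; move: F.
  apply: (@superder_rigid b) => [||i].
  - apply: homog_superderB => //; apply: vfield_homog => [|i]; rewrite ffunE; exact: homog_hpart.
  - by rewrite vfield_zfun ffunE Dz subrr.
  - by rewrite vfield_theta ffunE Dth subrr.
exists (v false + v true); apply/funext => F; rewrite vfieldD DE.
have [[_ p0 _] [_ p1 _]] := (hD0, hD1).
congr (_ + _).
  apply: (vP false) => // [|i]; rewrite DE; first by rewrite (hpart_homogD (p0 _ _ hz)) //; apply: p1.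
  by rewrite (hpart_homogD (p0 _ _ (hth i))) //; apply: (p1 _ _ (hth i)).
apply: (vP true) => // [|i]; rewrite DE addrC; first by rewrite (hpart_homogD (p1 _ _ hz)) //; apply: p0.
by rewrite (hpart_homogD (p1 _ _ (hth i))) //; apply: (p0 _ _ (hth i)).
Qed.

(** ** Regular vector fields *)

(** The two cases of regularity of a superfunction in one formula. *)
Lemma sregularE x F : sregular x F <-> forall I, regat x (F I * chart x ^- #|I|).
Proof.
case: x => [a|] //=; split=> h I; have := h I; rewrite expr1n invr1 mulr1 //.
Qed.

Lemma sregular_add x F G : sregular x F -> sregular x G -> sregular x (F + G).
Proof.
move=> /sregularE hF /sregularE hG; apply/sregularE => I.
by rewrite ffunE mulrDl; apply: regatD.
Qed.

Lemma sregular_scale x k F : regat x k -> sregular x F -> sregular x (kscale k F).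
Proof.
move=> hk /sregularE hF; apply/sregularE => I.
by rewrite ffunE -mulrA; apply: regatM.
Qed.

Lemma sregular0 x : sregular x (0 : SF).
Proof. by apply/sregularE => I; rewrite ffunE mul0r; apply: regat0. Qed.

Lemma sregular_sum x (s : seq 'I_m) (E : 'I_m -> SF) :
  (forall i, sregular x (E i)) -> sregular x (\sum_(i <- s) E i).
Proof. by move=> hE; elim/big_ind: _ => //; [apply: sregular0 | apply: sregular_add]. Qed.

Lemma sregular_smul x F G : sregular x F -> sregular x G -> sregular x (smul F G).
Proof.
move=> /sregularE hF /sregularE hG; apply/sregularE => S.
rewrite ffunE mulr_suml; apply: regat_sum => A AS.
have -> : chart x ^- #|S| = chart x ^- #|A| * chart x ^- #|S :\: A|.
  by rewrite -invfM -exprD -(cardsID A S) (setIidPr AS).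
rewrite mulrACA; apply: regatM => //.
by rewrite -mulrA; apply: regatM => //; apply: regat_sign.
Qed.

Lemma sregular_mono x k A : regat x (k * chart x ^- #|A|) -> sregular x (mono k A : SF).
Proof.
move=> hk; apply/sregularE => I; rewrite ffunE; case: eqP => [->//|_].
by rewrite mul0r; apply: regat0.
Qed.

Lemma sregular_dtheta x i F :
  sregular x F -> sregular x (kscale (chart x)^-1 (dtheta i F)).
Proof.
move=> /sregularE hF; apply/sregularE => I; rewrite !ffunE.
case: ifP => iI; first by rewrite mulr0 mul0r; apply: regat0.
have := hF (i |: I); rewrite cardsU1 iI exprD expr1 => h.
have -> : (chart x)^-1 * (sgn C [set i] I * F (i |: I)) * chart x ^- #|I| =
   sgn C [set i] I * (F (i |: I) * (chart x * chart x ^+ #|I|)^-1).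
  by rewrite invfM mulrCA -!mulrA; congr (_ * _); rewrite mulrCA.
by apply: regatM => //; apply: regat_sign.
Qed.

(** Minus the logarithmic derivative of the factor u. *)
Definition logchart x : K := if x is None then w else 0.

Lemma rder_chart x : rder (chart x) = - (logchart x * chart x).
Proof. by case: x => [a|]; rewrite /= ?mul0r ?oppr0 ?rder1 // rder_wcoord. Qed.

(** The Euler operator, which counts the thetas. *)
Definition euler F : SF := \sum_i smul (theta i) (dtheta i F).

Lemma eulerE F I : euler F I = F I *+ #|I|.
Proof.
elim/superfun_ind: F I => [F G hF hG|k A] I.
  rewrite ffunE mulrnDl -hF -hG.
  have -> : euler (F + G) = euler F + euler G; last by rewrite ffunE.
  by rewrite -big_split; apply: eq_bigr => i _; rewrite dthetaD smulDr.
have -> : euler (mono k A) = \sum_(i in A) mono k A.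
  rewrite /euler [RHS]big_mkcond; apply: eq_bigr => i _; rewrite dtheta_mono.
  case: ifP => [iA|_]; last by rewrite smul0.
  rewrite smul_mono set1I_notin ?inE ?eqxx // setD1K // mulr1 mulrA sgnK mul1r.
  by [].
by rewrite sumr_const ffunMnE ffunE; case: eqP => [->|_]; rewrite ?mul0rn.
Qed.

(** The derivative with respect to z at constant odd coordinates of the chart around x
    is d/dz + e E, where e is minus the logarithmic derivative of u and E the Euler
    operator; it is u^2 times a regular derivation. *)
Lemma sregular_dz x F : sregular x F ->
  sregular x (kscale (chart x ^- 2) (dz F + kscale (logchart x) (euler F))).
Proof.
move=> /sregularE hF; apply/sregularE => I; rewrite !ffunE eulerE.
have /regat_rder := hF I; set n := #|I|; set u := chart x; set phi := F I * u ^- n.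
have un0 : u ^+ n != 0 by apply/expf_neq0/chart_neq0.
have -> : F I = phi * u ^+ n by rewrite divfK.
rewrite rderM rderX rder_chart -/u.
suff -> : u ^- 2 * (rder phi * u ^+ n + phi * ((u ^+ n.-1 * - (logchart x * u)) *+ n)
   + logchart x * ((phi * u ^+ n) *+ n)) * u ^- n = rder phi * u ^- 2 by [].
have -> : (u ^+ n.-1 * - (logchart x * u)) *+ n = - (logchart x * u ^+ n *+ n).
  case: (n) => [|n']; first by rewrite !mulr0n oppr0.
  by rewrite mulrN mulNrn mulrCA -exprSr.
have -> : logchart x * (phi * u ^+ n *+ n) = phi * (logchart x * u ^+ n *+ n).
  by rewrite !mulrnAr mulrCA.
by rewrite mulrN -addrA addNr addr0 mulrA mulfK // mulrC.
Qed.

(** Regularity at x of the coefficients of the vector field in the coordinates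
    around x: at infinity these are - w^2 f and w (g_i - w f theta_i). *)
Definition local_field x v : Prop :=
  sregular x (kscale (chart x ^+ 2) (v None)) /\
  forall i, sregular x (kscale (chart x)
    (v (Some i) - kscale (logchart x) (smul (v None) (theta i)))).

(** The chain rule: the vector field in the coordinates around x. *)
Lemma vfield_chart x v F : vfield v F =
  smul (kscale (chart x ^+ 2) (v None))
       (kscale (chart x ^- 2) (dz F + kscale (logchart x) (euler F)))
  + \sum_i smul (kscale (chart x)
                 (v (Some i) - kscale (logchart x) (smul (v None) (theta i))))
                (kscale (chart x)^-1 (dtheta i F)).
Proof.
have u0 := chart_neq0 x.
rewrite smulZl smulZr kscaleA divff ?expf_neq0 // kscale1 smulDr -addrA; congr (_ + _).
rewrite smulZr smul_sumr -smul_scalel smul_sumr -big_split; apply: eq_bigr => i _.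
rewrite smulZl smulZr kscaleA divff // kscale1 smul_scalel smulBl smulZl smulA.
by rewrite /= addrCA subrr addr0.
Qed.

Lemma local_field_structure (V : set (P1 C)) v F :
  (forall x, V x -> local_field x v) -> structure_sheaf V F -> structure_sheaf V (vfield v F).
Proof.
move=> hv hF x Vx; have [hf hg] := hv x Vx; rewrite (vfield_chart x).
apply: sregular_add; first by apply: sregular_smul => //; apply: sregular_dz (hF x Vx).
by apply: sregular_sum => i; apply: sregular_smul => //; apply: sregular_dtheta (hF x Vx).
Qed.

Lemma zopen_remove (U : set (P1 C)) x : zopen U -> zopen (U `&` ~` [set x])%classic.
Proof.
move=> hU; rewrite /zopen classical_sets.setCI classical_sets.setCK.
by rewrite finite_setU; split=> //; apply: finite_set1.
Qed.

(** A superderivation preserving regularity near x has regular coefficients: these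
    are its values on the coordinates around x, which are regular on the complement
    of a single other point. *)
Lemma tangent_sheaf_local (U : set (P1 C)) v x : zopen U ->
  tangent_sheaf U (vfield v) -> U x -> local_field x v.
Proof.
move=> oU [_ hD] Ux; case: x Ux => [a|] Ux.
- pose V := (U `&` ~` [set None])%classic.
  have VD := hD V (zopen_remove _ oU) (@classical_sets.subIsetl _ _ _).
  have Va : V (Some a) by split.
  rewrite /local_field /= expr1n !kscale1.
  have sreg_a k A : (forall b : C, regat (Some b) k) -> structure_sheaf V (mono k A : SF).
    by move=> hk [b _|[_ /(_ erefl)]] //; apply: sregular_mono; rewrite /= expr1n divr1.
  split=> [|i].
    rewrite -vfield_zfun; apply: (VD _ _ _ Va); apply: sreg_a => b.
    exact: regat_tofrac.
  have -> : kscale 1 (v (Some i) - kscale 0 (smul (v None) (theta i))) = vfield v (theta i).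
    by rewrite kscale1 vfield_theta; apply/ffunP => I; rewrite !ffunE mul0r subr0.
  by apply: (VD _ _ _ Va); apply: sreg_a => b; apply: regat1.
- pose V := (U `&` ~` [set Some 0])%classic.
  have VD := hD V (zopen_remove _ oU) (@classical_sets.subIsetl _ _ _).
  have Va : V None by split.
  have sreg_w A : (#|A| <= 1)%N -> structure_sheaf V (mono w A : SF).
    move=> A1 [b|] [_ hb]; apply: sregular_mono.
      rewrite /= expr1n divr1; apply: regat_tofracV; rewrite hornerX.
      by apply/eqP => b0; apply: hb; rewrite b0.
    case: #|A| A1 => [|[|]] // _; first by rewrite divr1; apply: regat_wcoord.
    by rewrite divff ?wcoord_neq0 //; apply: regat1.
  split=> [|i].
    have -> : kscale (chart None ^+ 2) (v None) = kscale (-1) (vfield v (mono w set0)).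
      by rewrite vfield_even rder_wcoord kscaleA mulN1r opprK.
    apply: sregular_scale; first exact/regatN/regat1.
    by apply: (VD _ _ _ Va); apply: sreg_w; rewrite cards0.
  have -> : kscale (chart None) (v (Some i) - kscale (logchart None) (smul (v None) (theta i)))
      = vfield v (mono w [set i]).
    rewrite vfield_odd rder_wcoord /=; apply/ffunP => I; rewrite !ffunE.
    by rewrite mulrDr mulrN mulrA mulNr.
  by apply: (VD _ _ _ Va); apply: sreg_w; rewrite cards1.
Qed.

Lemma tangent_sheafP (U : set (P1 C)) v : zopen U ->
  tangent_sheaf U (vfield v) <-> forall x, U x -> local_field x v.
Proof.
move=> oU; split=> [hD x Ux|hv]; first exact: tangent_sheaf_local hD Ux.
split=> [|V _ VU F]; first exact: vfield_superder.
by apply: local_field_structure => x /VU; apply: hv.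
Qed.

End Superderivations.

(** * Splitting the tangent sheaf into line bundles *)

Section Splitting.

Import mathcomp.boot.fintype mathcomp.boot.finset.

Variables (C : closedFieldType) (m : nat).
Local Notation K := (ratfun C).
Local Notation SF := (superfun C m).
Local Notation z := (zcoord C).
Local Notation w := (wcoord C).
Local Notation coefs := (coefs C m).
Implicit Types (A B I J S : {set 'I_m}) (a c k : K) (i j : 'I_m).
Implicit Types (v : coefs) (x : P1 C).

(** The summands: (None, I) carries a modification of f_I and (Some i, J) one of
    g_(i, J). *)
Definition lines : finType := (option 'I_m * {set 'I_m})%type.
Definition coords := {ffun lines -> K}.
Implicit Types (y : coords).

Definition first_out I : option 'I_m := [pick i | i \notin I].

Variant first_out_spec I : option 'I_m -> Prop :=
  | FirstOut j of j \notin I : first_out_spec I (Some j)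
  | FirstOutFull of I = setT : first_out_spec I None.

Lemma first_outP I : first_out_spec I (first_out I).
Proof.
rewrite /first_out; case: pickP => [j jI|I0]; constructor => //.
by apply/setP => i; rewrite inE; apply/negbFE/I0.
Qed.

Lemma first_out_notin I j : first_out I = Some j -> j \notin I.
Proof. by rewrite /first_out; case: pickP => // i iI [<-]. Qed.

(** The sign in theta_I theta_i = eps i I theta_(I U i). *)
Definition eps i I : K := sgn C I [set i].

Lemma epsK i I : eps i I * eps i I = 1.
Proof. exact: sgnK. Qed.

(** What is subtracted from f_I, and from g_(i, I U i) with i outside I.  With j the
    first index outside I, the new coordinates are f_I - z eps_j g_j, g_j itself, and
    g_i - eps_i eps_j g_j for the other i.  Only the g_j, which are not
    modified, enter, so that the change of coordinates is inverted by adding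
    instead of subtracting. *)
Definition shear (h : 'I_m -> {set 'I_m} -> K) (o : option 'I_m) J : K :=
  match o with
  | None => if first_out J is Some j then z * eps j J * h j (j |: J) else 0
  | Some i =>
      if i \in J then
        if first_out (J :\ i) is Some j then
          if j == i then 0 else
          eps i (J :\ i) * eps j (J :\ i) * h j (j |: J :\ i)
        else 0
      else 0
  end.

Arguments shear : simpl never.

Definition to_lines v : coords :=
  [ffun t => v t.1 t.2 - shear (fun j J => v (Some j) J) t.1 t.2].

Definition of_lines y : coefs :=
  [ffun o => [ffun J => y (o, J) + shear (fun j J => y (Some j, J)) o J]].

Lemma shear_pivot h j I : first_out I = Some j -> shear h (Some j) (j |: I) = 0.
Proof.
move=> Ij; have jI := first_out_notin Ij.
by rewrite /shear !inE eqxx /= setU1K // Ij eqxx.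
Qed.

Lemma shear_ext h h' : (forall j I, first_out I = Some j -> h j (j |: I) = h' j (j |: I)) ->
  shear h =2 shear h'.
Proof.
rewrite /shear => hh' [i|] J.
  case: ifP => // _; case E : (first_out _) => [j|] //.
  by rewrite (hh' _ _ E).
by case E : (first_out _) => [j|] //; rewrite (hh' _ _ E).
Qed.

Lemma to_linesK : cancel to_lines of_lines.
Proof.
move=> v; apply/ffunP => o; apply/ffunP => J; rewrite !ffunE /= -addrA addrC.
rewrite (@shear_ext (fun j J => to_lines v (Some j, J)) (fun j J => v (Some j) J)) ?addNr ?add0r // => j I Ij.
by rewrite ffunE /= (shear_pivot _ Ij) subr0.
Qed.

Lemma of_linesK : cancel of_lines to_lines.
Proof.
move=> y; apply/ffunP => -[o J]; rewrite !ffunE /=.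
rewrite (@shear_ext (fun j J => of_lines y (Some j) J) (fun j J => y (Some j, J))) ?addrK // => j I Ij.
by rewrite !ffunE (shear_pivot _ Ij) addr0.
Qed.

Lemma shearD h h' o J :
  shear (fun j J => h j J + h' j J) o J = shear h o J + shear h' o J.
Proof.
rewrite /shear; case: o => [i|]; last by case: first_out => [j|]; rewrite ?addr0 ?mulrDr.
case: ifP => _; last by rewrite addr0.
by case: first_out => [j|]; rewrite ?addr0 //; case: ifP => _; rewrite ?addr0 ?mulrDr.
Qed.

Lemma shearZ k h o J : shear (fun j J => k * h j J) o J = k * shear h o J.
Proof.
rewrite /shear; case: o => [i|]; last by case: first_out => [j|]; rewrite ?mulr0 // mulrCA.
case: ifP => _; last by rewrite mulr0.
by case: first_out => [j|]; rewrite ?mulr0 //; case: ifP => _; rewrite ?mulr0 // mulrCA.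
Qed.

Lemma of_linesD y y' : of_lines (y + y') = of_lines y + of_lines y'.
Proof.
apply/ffunP => o; apply/ffunP => J; rewrite !ffunE addrACA -shearD; congr (_ + _).
by apply: shear_ext => j I _; rewrite ffunE.
Qed.

Lemma of_linesZ (c : C) y :
  of_lines [ffun t => Defs.scalar c * y t] = [ffun o => sscale c (of_lines y o)].
Proof.
apply/ffunP => o; apply/ffunP => J; rewrite !ffunE mulrDr -shearZ; congr (_ + _).
by apply: shear_ext => j I _; rewrite ffunE.
Qed.

(** The exponent e for which the summand is the line bundle of degree 2 - e. *)
Definition twisting (t : lines) : nat :=
  match t.1 with
  | None => #|t.2| + isSome (first_out t.2)
  | Some i => #|t.2| + ~~ ((i \in t.2) && (first_out (t.2 :\ i) == Some i))
  end.

(** Regularity at x of a section of the line bundle of degree 2 - e. *)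
Definition line_regular (e : nat) x k : Prop :=
  regat x (if x is None then k * z ^+ e * w ^+ 2 else k).

Lemma smul_theta (f : SF) i J :
  smul f (theta C i) J = if i \in J then eps i (J :\ i) * f (J :\ i) else 0.
Proof.
elim/superfun_ind: f => [f g hf hg|a A].
  by rewrite smulDl ffunE hf hg ffunE; case: ifP => _; rewrite ?addr0 ?mulrDr.
rewrite smul_mono mulr1 [A :&: _]setIC [A :|: _]setUC.
have [iA|iA] := boolP (i \in A).
  rewrite ifN ?ffunE; last by apply/set0Pn; exists i; rewrite !inE eqxx.
  case: ifP => // iJ; rewrite ifN ?mulr0 //; apply: contraTneq iA => <-.
  by rewrite !inE eqxx.
rewrite set1I_notin // eqxx ffunE; case: eqP => [->|JA].
  by rewrite !inE eqxx setU1K // ffunE eqxx.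
case: ifP => // iJ; rewrite ffunE ifN ?mulr0 //; apply: contra_notN JA => /eqP <-.
by rewrite setD1K.
Qed.

Lemma local_field_affine (a : C) v :
  local_field (Some a) v <-> forall o J, regat (Some a) (v o J).
Proof.
rewrite /local_field /= expr1n kscale1.
have E i : kscale 1 (v (Some i) - kscale 0 (smul (v None) (theta C i))) = v (Some i).
  by apply/ffunP => J; rewrite !ffunE mul0r subr0 mul1r.
split=> [[hf hg] [i|] J|h]; first by have := hg i J; rewrite E.
  exact: hf.
by split=> [I|i J]; [|rewrite E]; apply: h.
Qed.

(** How the new coordinates at infinity combine the conditions on f, g_i and g_j; here
    f, g and g' stand for f_I, g_i and g_j, and Z for z^k, where k is the cardinal
    of I. *)
Section InftyIdentities.

Variables (R : comNzRingType) (zR wR : R).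
Hypothesis zw1 : zR * wR = 1.

Lemma infty_free_id (f g e Z : R) : e * e = 1 ->
  (f - zR * e * g) * (Z * zR) * wR ^+ 2 = - e * ((g - wR * e * f) * Z).
Proof.
move=> ee; transitivity (f * Z * wR * (zR * wR) - e * g * Z * (zR * wR) * (zR * wR)).
  by ring.
by rewrite zw1 !mulr1 -[f in LHS]mul1r -ee; ring.
Qed.

Lemma infty_pivot_id (f g e Z : R) :
  g * (Z * zR) * wR ^+ 2 = wR * ((g - wR * e * f) * Z) + e * (f * Z * wR ^+ 2).
Proof. by transitivity (g * Z * wR * (zR * wR)); [ring | rewrite zw1; ring]. Qed.

Lemma infty_difference_id (f g g' e e' Z : R) : e' * e' = 1 ->
  (g - e * e' * g') * (Z * zR * zR) * wR ^+ 2 =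
  (g - wR * e * f) * Z - e * e' * ((g' - wR * e' * f) * Z).
Proof.
move=> ee; transitivity ((g - e * e' * g') * Z * (zR * wR) * (zR * wR)); first by ring.
rewrite zw1 !mulr1; transitivity ((g - e * e' * g') * Z - wR * e * f * Z + (e' * e') * (wR * e * f * Z)).
  by rewrite ee; ring.
by ring.
Qed.

Lemma infty_outer_id (g Z : R) : g * (Z * zR) * wR ^+ 2 = g * Z * wR.
Proof. by transitivity (g * Z * wR * (zR * wR)); [ring | rewrite zw1 mulr1]. Qed.

Lemma infty_inner_id (f g e Z : R) :
  wR * (g - wR * (e * f)) * (zR * Z) = (g - wR * e * f) * Z.
Proof. by transitivity ((zR * wR) * (g - wR * (e * f)) * Z); [ring | rewrite zw1; ring]. Qed.

End InftyIdentities.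

Lemma wcoordVX n : w ^- n = z ^+ n.
Proof. by rewrite -exprVn invrK. Qed.

(** The coefficients of w^2 f and of w (g_i - w f theta_i), for J without i and for
    J = I U {i}. *)
Lemma local_field_infty v : local_field None v <->
  [/\ forall I, regat None (v None I * z ^+ #|I| * w ^+ 2),
      forall i J, i \notin J -> regat None (v (Some i) J * z ^+ #|J| * w)
    & forall i I, i \notin I ->
        regat None ((v (Some i) (i |: I) - w * eps i I * v None I) * z ^+ #|I|)].
Proof.
have Ef I : kscale (chart None ^+ 2) (v None) I * chart None ^- #|I| =
    v None I * z ^+ #|I| * w ^+ 2.
  by rewrite ffunE wcoordVX -mulrA mulrC.
have Eg i J : i \notin J -> kscale (chart None)
    (v (Some i) - kscale (logchart None) (smul (v None) (theta C i))) J * chart None ^- #|J| =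
    v (Some i) J * z ^+ #|J| * w.
  move=> iJ; rewrite 4!ffunE smul_theta (negbTE iJ) mulr0 subr0 wcoordVX.
  by rewrite -mulrA mulrC.
have Eh i I : i \notin I -> kscale (chart None)
    (v (Some i) - kscale (logchart None) (smul (v None) (theta C i))) (i |: I)
      * chart None ^- #|i |: I| =
    (v (Some i) (i |: I) - w * eps i I * v None I) * z ^+ #|I|.
  move=> iI; rewrite 4!ffunE smul_theta !inE eqxx setU1K // wcoordVX cardsU1 iI.
  rewrite exprD expr1; exact: infty_inner_id (mulzw C) _ _ _ _.
split=> [[/sregularE hf hg]|[h1 h2 h3]].
  split=> [I|i J iJ|i I iI]; first by rewrite -Ef; apply: hf.
    by rewrite -(Eg _ _ iJ); have /sregularE := hg i; apply.
  by rewrite -(Eh _ _ iI); have /sregularE := hg i; apply.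
split=> [|i]; apply/sregularE => J; first by rewrite Ef; apply: h1.
have [iJ|iJ] := boolP (i \in J); last by rewrite Eg //; apply: h2.
by have [I iI ->] := set1U_split iJ; rewrite Eh //; apply: h3.
Qed.

Lemma regat_shear (a : C) h o J : (forall j J, regat (Some a) (h j J)) ->
  regat (Some a) (shear h o J).
Proof.
move=> hh; have he j I : regat (Some a) (eps j I) by apply: regat_sign.
have hz : regat (Some a) z by apply: regat_tofrac.
have h0 := regat0 (Some a).
rewrite /shear; case: o => [i|]; last by case: first_out => [j|] //; apply: regatM => //; apply: regatM.
case: ifP => // _; case: first_out => [j|] //; case: ifP => // _.
by apply: regatM => //; apply: regatM.
Qed.

(** The new coordinates turn the tangent sheaf into a direct sum of line bundles: at
    infinity the two systems of conditions are related by an invertible matrix with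
    entries in the local ring. *)
Lemma local_field_lines x y :
  local_field x (of_lines y) <-> forall t, line_regular (twisting t) x (y t).
Proof.
rewrite -{2}[y]of_linesK; move: (of_lines y) => v {y}.
case: x => [a|].
  rewrite local_field_affine; split=> [h [o J]|h o J].
    by rewrite /line_regular ffunE; apply: regatB => //; apply: regat_shear.
  rewrite -[v]to_linesK 2!ffunE; apply: regatD; first exact: h (o, J).
  by apply: regat_shear => j I; apply: h (Some j, I).
have he j I : regat None (eps j I) by apply: regat_sign.
have hw := regat_wcoord C.
(* n1, n2 and n3 are the conditions on the coefficients, l those on the new
   coordinates. *)
pose n1 I := v None I * z ^+ #|I| * w ^+ 2.
pose n2 i J := v (Some i) J * z ^+ #|J| * w.
pose n3 i I := (v (Some i) (i |: I) - w * eps i I * v None I) * z ^+ #|I|.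
pose l t := to_lines v t * z ^+ twisting t * w ^+ 2.
have l_full I : first_out I = None -> l (None, I) = n1 I.
  by move=> I0; rewrite /l /twisting ffunE /shear /= I0 subr0 addn0.
have l_none j I : first_out I = Some j -> l (None, I) = - eps j I * n3 j I.
  move=> Ij; rewrite /l /twisting ffunE /shear /= Ij addn1 exprSr.
  exact: infty_free_id (mulzw C) _ _ _ _ (epsK j I).
have l_out i J : i \notin J -> l (Some i, J) = n2 i J.
  move=> iJ; rewrite /l /twisting ffunE /shear /= (negbTE iJ) subr0 addn1 exprSr.
  exact: infty_outer_id (mulzw C) _ _.
have l_pivot j I : first_out I = Some j ->
    l (Some j, j |: I) = w * n3 j I + eps j I * n1 I.
  move=> Ij; have jI := first_out_notin Ij.
  rewrite /l /twisting ffunE /= (shear_pivot _ Ij) subr0 !inE eqxx setU1K // Ij eqxx.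
  rewrite addn0 cardsU1 jI add1n exprSr.
  exact: infty_pivot_id (mulzw C) _ _ _ _.
have l_in i j I : first_out I = Some j -> i \notin I -> i != j ->
    l (Some i, i |: I) = n3 i I - eps i I * eps j I * n3 j I.
  move=> Ij iI ij.
  rewrite /l /twisting ffunE /shear /= !inE eqxx setU1K // Ij (inj_eq Some_inj) eq_sym (negbTE ij) /=.
  rewrite cardsU1 iI add1n addn1 [z ^+ #|I|.+2]exprSr [z ^+ #|I|.+1]exprSr.
  exact: infty_difference_id (mulzw C) _ _ _ _ _ _ (epsK j I).
rewrite local_field_infty; split=> [[h1 h2 h3]|h].
  move=> [[i|] J]; rewrite /line_regular -/(l _); last first.
    case E : (first_out J) => [j|]; last by rewrite l_full //; apply: h1.
    rewrite (l_none _ _ E); apply: regatM; first exact: regatN.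
    exact: h3 (first_out_notin E).
  have [iJ|iJ] := boolP (i \in J); last by rewrite l_out //; apply: h2.
  have [I iI ->] := set1U_split iJ; case E : (first_out I) => [j|]; last first.
    by case: first_outP E iI => // ->; rewrite inE.
  have n3j := h3 _ _ (first_out_notin E).
  have [->|ij] := eqVneq i j.
    by rewrite l_pivot //; apply: regatD; apply: regatM => //; apply: h1.
  rewrite (l_in _ _ _ E) //; apply: regatB; first exact: h3.
  by apply: regatM => //; apply: regatM.
have hl t : regat None (l t) by apply: h.
have n3j j I : first_out I = Some j -> regat None (n3 j I).
  move=> E; rewrite -[n3 j I]mul1r -(epsK j I) -mulrA -[_ * n3 j I]opprK -mulNr -(l_none _ _ E).
  by apply: regatM => //; apply: regatN.
split=> [I|i J iJ|i I iI]; last 2 first.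
- by rewrite -/(n2 i J) -l_out.
- rewrite -/(n3 i I); case E : (first_out I) => [j|]; last first.
    by case: first_outP E iI => // ->; rewrite inE.
  have [->|ij] := eqVneq i j; first exact: n3j.
  rewrite -[n3 i I](subrK (eps i I * eps j I * n3 j I)) -(l_in _ _ _ E) //.
  by apply: regatD => //; apply: regatM; [apply: regatM | apply: n3j].
- rewrite -/(n1 I); case E : (first_out I) => [j|]; last by rewrite -l_full.
  rewrite -[n1 I]mul1r -(epsK j I) -mulrA; apply: regatM => //.
  rewrite -[_ * n1 I](addKr (w * n3 j I)) -l_pivot // addrC.
  by apply: regatB => //; apply: regatM => //; apply: n3j.
Qed.

End Splitting.

(** * Cohomology *)

Lemma cohomologous_id (V : zmodType) (a b c d e f u : V) :
  a - b - (c - d) + ((b - e) - (d - f) + u) = a - c + (u - e + f).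
Proof.
rewrite addrA addrACA subrKA -opprD subrKA opprB !addrA.
by rewrite [LHS](ACl (1*4*5*2*3)).
Qed.

Lemma coboundary_id (V : zmodType) (a b c d g : V) :
  a - b - (c - d) = a - c + g - (b - d + g).
Proof.
rewrite [- (_ + g)]opprD [RHS]addrACA subrr addr0 !opprB !addrA.
by rewrite [LHS](ACl (1*4*3*2)).
Qed.

Section Cohomology.

Variables (C : closedFieldType) (m : nat).
Local Notation K := (ratfun C).
Local Notation SF := (superfun C m).
Local Notation z := (zcoord C).
Local Notation w := (wcoord C).
Local Notation coords := (coords C m).
Local Notation lines := (lines m).
Implicit Types (a : C) (y : coords) (x : P1 C) (t : lines) (F : SF).

Definition cscale (c : C) y : coords := [ffun t => Defs.scalar c * y t].

(** The superderivation with coordinates y. *)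
Definition der y : SF -> SF := vfield (of_lines y).

Lemma derD y y' F : der (y + y') F = der y F + der y' F.
Proof. by rewrite /der of_linesD vfieldD. Qed.

Lemma der0 F : der 0 F = 0.
Proof. by apply: (addIr (der 0 F)); rewrite -derD !add0r. Qed.

Lemma derB y y' F : der (y - y') F = der y F - der y' F.
Proof. by apply/(canRL (addrK _)); rewrite -derD subrK. Qed.

Lemma derZ c y F : der (cscale c y) F = sscale c (der y F).
Proof. by rewrite /der of_linesZ vfieldZ. Qed.

Lemma der_sum (I : Type) (r : seq I) (E : I -> coords) F :
  der (\sum_(i <- r) E i) F = \sum_(i <- r) der (E i) F.
Proof.
elim: r => [|i r IHr]; first by rewrite !big_nil der0.
by rewrite !big_cons derD IHr.
Qed.

Lemma der_inj y y' : (forall F, der y F = der y' F) -> y = y'.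
Proof.
move=> e; apply: (can_inj (@of_linesK C m)); apply/ffunP => -[i|].
  by rewrite -!(vfield_theta (of_lines _)); apply: e.
by rewrite -!(vfield_zfun (of_lines _)); apply: e.
Qed.

Lemma superder_der (D : SF -> SF) : superder D -> exists y, D = der y.
Proof. by move=> /superder_vfield[v ->]; exists (to_lines v); rewrite /der to_linesK. Qed.

Definition sections x y : Prop := forall t, line_regular (twisting t) x (y t).

Lemma tangent_der (U : set (P1 C)) y : zopen U ->
  tangent_sheaf U (der y) <-> forall x, U x -> sections x y.
Proof.
move=> oU; rewrite tangent_sheafP //.
by split=> h x Ux; have := h x Ux; rewrite local_field_lines.
Qed.

Lemma line_regularD e x f g :
  line_regular e x f -> line_regular e x g -> line_regular e x (f + g).
Proof.
by rewrite /line_regular; case: x => [a|]; rewrite ?mulrDl; apply: regatD.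
Qed.

Lemma line_regularN e x f : line_regular e x f -> line_regular e x (- f).
Proof.
by rewrite /line_regular; case: x => [a|]; rewrite ?mulNr; apply: regatN.
Qed.

Lemma sectionsD x y y' : sections x y -> sections x y' -> sections x (y + y').
Proof. by move=> h h' t; rewrite ffunE; apply: line_regularD. Qed.

Lemma sectionsN x y : sections x y -> sections x (- y).
Proof. by move=> h t; rewrite ffunE; apply: line_regularN. Qed.

Lemma sectionsB x y y' : sections x y -> sections x y' -> sections x (y - y').
Proof. by move=> h h'; apply/sectionsD/sectionsN. Qed.

Lemma sections0 x : sections x 0.
Proof.
move=> t; rewrite ffunE /line_regular; case: x => [a|]; rewrite ?mul0r; exact: regat0.
Qed.

Lemma coordsB y y' t : (y - y') t = y t - y' t.
Proof. by rewrite !ffunE. Qed.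

(** ** Linear combinations of monomials *)

Section Combinations.

(* The vectors gen j with j < dim t, placed in the coordinate t. *)
Variables (dim : lines -> nat) (gen : nat -> K).

Definition basis_index : finType := {t : lines & 'I_(dim t)}.

Definition basis (b : basis_index) : coords :=
  [ffun t => if t == tag b then gen (tagged b) else 0].

Definition comb (c : {ffun 'I_#|basis_index| -> C}) : coords :=
  \sum_k cscale (c k) (basis (enum_val k)).

Definition comb_coef (c : {ffun 'I_#|basis_index| -> C}) t (j : 'I_(dim t)) : C :=
  c (enum_rank (Tagged (fun t => 'I_(dim t)) j : basis_index)).

Lemma combE c t : comb c t = \sum_(j < dim t) Defs.scalar (comb_coef c j) * gen j.
Proof.
rewrite sum_ffunE (reindex (@enum_rank basis_index)) /=; last first.
  by exists (@enum_val _ basis_index) => k _; rewrite ?enum_valK ?enum_rankK.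
pose G t' (j : 'I_(dim t')) := Defs.scalar (comb_coef c j) * (if t == t' then gen j else 0).
transitivity (\sum_(p : basis_index) G (tag p) (tagged p)).
  by apply: eq_bigr => p _; rewrite !ffunE enum_rankK /G /comb_coef; case: p.
rewrite -(sig_big_dep (fun=> true) (fun _ _ => true) G) /=.
rewrite (bigD1 t) //= [X in _ + X]big1 ?addr0 => [|t' t't].
  by apply: eq_bigr => j _; rewrite /G eqxx.
by apply: big1 => j _; rewrite /G eq_sym (negbTE t't) mulr0.
Qed.

Lemma comb_coef_inj c c' :
  (forall t (j : 'I_(dim t)), comb_coef c j = comb_coef c' j) -> c = c'.
Proof.
move=> e; apply/ffunP => k; have := e _ (tagged (enum_val k)).
by rewrite /comb_coef -[Tagged _ _]/(Tagged _ _); case: (enum_val k) (enum_valK k) => t j /= ->.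
Qed.

(** The coefficients of a combination can be prescribed line by line. *)
Lemma exists_comb (c : forall t, 'I_(dim t) -> C) :
  exists c', forall t (j : 'I_(dim t)), comb_coef c' j = c t j.
Proof.
exists [ffun k => c _ (tagged (enum_val k))] => t j.
by rewrite /comb_coef ffunE enum_rankK.
Qed.

Lemma der_comb c F : der (comb c) F = \sum_k sscale (c k) (der (basis (enum_val k)) F).
Proof. by rewrite der_sum; apply: eq_bigr => k _; rewrite derZ. Qed.

End Combinations.

(** ** Global sections *)

Definition h0_index := basis_index (fun t => 3 - twisting t)%N.

Lemma sum_scalar_zX n (c : 'I_n -> C) :
  \sum_j Defs.scalar (c j) * z ^+ j = tofrac (\sum_j c j *: 'X^j).
Proof.
by rewrite rmorph_sum; apply: eq_bigr => j _; rewrite -mul_polyC rmorphM rmorphXn.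
Qed.

Lemma coef_sum_scale n (c : 'I_n -> C) (i : 'I_n) : (\sum_j c j *: 'X^j)`_i = c i.
Proof.
rewrite coef_sum (bigD1 i) //= coefZ coefXn eqxx mulr1 big1 ?addr0 // => j ji.
by rewrite coefZ coefXn eq_sym (inj_eq val_inj) (negbTE ji) mulr0.
Qed.

Lemma tangent_h0_lines : tangent_h0 C m #|h0_index|.
Proof.
exists (fun k => der (basis (fun j => z ^+ j) (enum_val k))); split=> [k|D hD].
  apply/tangent_der => [|x _ t]; first by rewrite /zopen classical_sets.setCT.
  rewrite ffunE; case: eqP => [->|_]; last first.
    have := sections0 x t; by rewrite ffunE.
  case: (enum_val k) => t' j /=; rewrite /line_regular.
  case: x => [a|]; first by apply: regatX; apply: regat_tofrac.
  have -> : z ^+ j = tofrac 'X^j by rewrite rmorphXn.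
  apply/regat_infty_poly; right; rewrite size_polyXn.
  by have := ltn_ord j; rewrite ltn_subRL addnC.
have [y yE] := superder_der hD.1; subst D.
have oT : zopen [set: P1 C]%classic by rewrite /zopen classical_sets.setCT.
have {}hD := proj1 (tangent_der _ oT) hD.
have hp t : exists p : {poly C}, y t = tofrac p /\ (size p <= 3 - twisting t)%N.
  have [|p yp] := @regat_affine_poly _ (y t); first by move=> a; apply: (hD (Some a) I t).
  exists p; split=> //; have := hD None I t; rewrite /line_regular yp.
  case/regat_infty_poly => [->|]; first by rewrite size_poly0.
  by move: (size p) (twisting t) => n e; lia.
have [p pP] := choice hp.
have [c cE] := exists_comb (dim := fun t => (3 - twisting t)%N) (fun t j => (p t)`_j).
have cP (c' : {ffun 'I_#|h0_index| -> C}) :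
    (forall F, der y F = \sum_k sscale (c' k) (der (basis (fun j => z ^+ j) (enum_val k)) F))
    <-> (forall t (j : 'I_(3 - twisting t)), comb_coef c' j = (p t)`_j).
  transitivity (y = comb (fun j => z ^+ j) c').
    split=> [e|-> F]; last exact: der_comb.
    by apply: der_inj => F; rewrite e der_comb.
  split=> [e t j|e].
    have [ye _] := pP t; move/eqP: ye; rewrite e combE sum_scalar_zX tofrac_eq => /eqP <-.
    by rewrite (coef_sum_scale (comb_coef c' (t := t)) j).
  apply/ffunP => t; have [-> sz] := pP t; rewrite combE sum_scalar_zX; congr tofrac.
  rewrite -[p t](coefK) poly_def (big_ord_widen _ (fun i => (p t)`_i *: 'X^i) sz) big_mkcond /=.
  apply: eq_bigr => j _; rewrite e; case: ltnP => // szj.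
  by rewrite nth_default // scale0r.
exists c; split=> [|c' /cP e]; first exact/cP.
by apply: comb_coef_inj => t j; rewrite e cE.
Qed.

(** ** Cocycles *)

Lemma zopenI (U V : set (P1 C)) : zopen U -> zopen V -> zopen (U `&` V)%classic.
Proof. by move=> oU oV; rewrite /zopen classical_sets.setCI finite_setU. Qed.

(** The cocycle s is the coboundary of the generic sections eta. *)
Definition primitive (U : Defs.cover C) (s : cidx U -> cidx U -> SF -> SF)
    (eta : cidx U -> coords) : Prop :=
  forall i j, s i j = der (eta i - eta j).

(** Generically every cocycle is a coboundary, since the nonempty open sets all meet
    in the generic point. *)
Lemma cocycle_primitive (U : Defs.cover C) (s : cidx U -> cidx U -> SF -> SF) (i0 : cidx U) :
  cocycle s -> exists2 eta, primitive s eta & eta i0 = 0.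
Proof.
move=> [hs hadd].
have hsig ij : exists y, s ij.1 ij.2 = der y by apply: superder_der; case: (hs ij.1 ij.2).
have [sig sigP] := choice hsig.
have sigE i j k : sig (i, k) = sig (i, j) + sig (j, k).
  by apply: der_inj => F; rewrite derD -(sigP (i, k)) -(sigP (i, j)) -(sigP (j, k)) /= (hadd i j k).
exists (fun i => sig (i, i0)) => [i j|].
  by rewrite (sigE i j i0) addrK -(sigP (i, j)).
by apply: (addIr (sig (i0, i0))); rewrite add0r -sigE.
Qed.

Lemma primitive_sections (U : Defs.cover C) (s : cidx U -> cidx U -> SF -> SF) eta i j x :
  cocycle s -> primitive s eta -> copen i x -> copen j x -> sections x (eta i - eta j).
Proof.
move=> [hs _] hp xi xj; have := hs i j; rewrite hp.
by rewrite tangent_der; [apply; split | apply: zopenI; apply: copenP].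
Qed.

(** Two cocycles are cohomologous when their primitives differ, locally on the
    curve, by one generic section up to regular sections.  On the intersections of
    the two covers the differences then form the required cochain. *)
Lemma cohomologousP (U U' : Defs.cover C)
    (s : cidx U -> cidx U -> SF -> SF) (s' : cidx U' -> cidx U' -> SF -> SF) eta eta' :
  cocycle s -> cocycle s' -> primitive s eta -> primitive s' eta' ->
  cohomologous s s' <->
  exists g, forall i j x, copen i x -> copen j x -> sections x (eta i - eta' j + g).
Proof.
move=> cs cs' ps ps'; split=> [[W [r [r' [h [rU rU' ht hE]]]]]|[g gP]].
  have [l0 _] := coverP W None.
  have htau k : exists y, h k = der y by apply: superder_der; case: (ht k).
  have [tau tauP] := choice htau.
  exists (tau l0 - eta (r l0) + eta' (r' l0)) => i j x ix jx.
  have [k kx] := coverP W x.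
  have := primitive_sections cs ps ix (rU k x kx).
  have := primitive_sections cs' ps' jx (rU' k x kx).
  have : sections x (tau k).
    by have := ht k; rewrite tauP tangent_der; [apply | apply: copenP].
  have E : tau k = (eta (r k) - eta (r l0)) - (eta' (r' k) - eta' (r' l0)) + tau l0.
    apply: der_inj => F; rewrite derD derB -ps -ps' hE !tauP subrK.
    by [].
  move=> h1 h2 h3; have := sectionsD (sectionsB h3 h2) h1.
  by congr (sections x _); rewrite E; apply: cohomologous_id.
pose W := @Cover C (cidx U * cidx U')%type (fun k => copen k.1 `&` copen k.2)%classic
  (fun k => zopenI (copenP k.1) (copenP k.2)).
have covW x : exists k : cidx U * cidx U', (copen k.1 `&` copen k.2)%classic x.
  by have [i ix] := coverP U x; have [j jx] := coverP U' x; exists (i, j).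
exists (W covW), fst, snd, (fun k => der (eta k.1 - eta' k.2 + g)); split.
- by move=> k x [].
- by move=> k x [].
- move=> k; rewrite tangent_der; last exact: copenP.
  by move=> x [kx kx']; apply: gP.
- move=> k l F; rewrite ps ps' -!derB; congr (der _ F).
  exact: coboundary_id.
Qed.

(** ** The standard cover *)

(** The complement of infinity for true, of the origin for false. *)
Definition standard_open (i : bool) : set (P1 C) := (~` [set if i then None else Some 0])%classic.

Lemma standard_zopen i : zopen (standard_open i).
Proof. by rewrite /zopen classical_sets.setCK; apply: finite_set1. Qed.

Lemma standard_cover_all x : exists i, standard_open i x.
Proof. by case: x => [a|]; [exists true | exists false]. Qed.

Definition standard_cover : Defs.cover C := Cover standard_zopen standard_cover_all.

Definition h1_index := basis_index (fun t => twisting t - 3)%N.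
(** The polar parts at infinity that represent H^1 of a line bundle. *)
Definition polar (j : nat) : K := w ^+ j.+1.

(** The primitive with value y around infinity and 0 on the affine line. *)
Definition standard_primitive y (i : bool) : coords := if i then 0 else y.

Definition standard_cocycle y (i j : cidx standard_cover) : SF -> SF :=
  der (standard_primitive y i - standard_primitive y j).

Lemma standard_openI x : standard_open true x -> standard_open false x ->
  exists2 a, a != 0 & x = Some a.
Proof.
case: x => [a _ h|h _]; last by case: h.
by exists a => //; apply/eqP => a0; apply: h; rewrite a0.
Qed.

Lemma standard_cocycleP y : (forall a, a != 0 -> sections (Some a) y) ->
  cocycle (standard_cocycle y).
Proof.
move=> hy; split=> [i j|i j k F]; last by rewrite -derD addrA subrK.
apply/tangent_der => [|x [ix jx]]; first by apply: zopenI; apply: copenP.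
case: i j ix jx => -[] ix jx; rewrite /= ?subrr ?subr0 ?sub0r; try exact: sections0.
  by have [a a0 ->] := standard_openI ix jx; apply/sectionsN/hy.
by have [a a0 ->] := standard_openI jx ix; apply: hy.
Qed.

Lemma sections_comb_polar a (c : {ffun 'I_#|h1_index| -> C}) :
  a != 0 -> sections (Some a) (comb polar c).
Proof.
move=> a0 t; rewrite combE /line_regular; apply: regat_sum => j _.
apply: regatM; first exact: regat_scalar.
by apply/regatX/regat_tofracV; rewrite hornerX.
Qed.

Lemma comb_polarB (c c' : {ffun 'I_#|h1_index| -> C}) t :
  (comb polar c - comb polar c') t =
  \sum_(j < twisting t - 3) Defs.scalar (comb_coef c j - comb_coef c' j) * w ^+ j.+1.
Proof.
rewrite 2!ffunE !combE -sumrB; apply: eq_bigr => j _.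
by rewrite rmorphB mulrBl.
Qed.

(** Every class comes from a polar part at infinity.  Only the finitely many points
    outside one member of the cover can carry polar parts on the affine line, and
    one global rational correction removes these. *)
Lemma cocycle_standard (V : Defs.cover C) (eta : cidx V -> coords) :
  (forall i j x, copen i x -> copen j x -> sections x (eta i - eta j)) ->
  exists (c : {ffun 'I_#|h1_index| -> C}) g, forall i (j : bool) x,
    copen i x -> standard_open j x ->
    sections x (eta i - standard_primitive (comb polar c) j + g).
Proof.
move=> heta; have [i0 i0x] := coverP V None.
have [s sE] : exists s : seq (option C), (~` copen i0)%classic = [set` s]%classic.
  by apply/(@finite_seqP (option C)); apply: copenP.
have [ix ixP] := choice (fun a => coverP V (Some a)).
have hh t : exists h, forall a, if a \in pmap id s
    then regat (Some a) (h - (eta (ix a) - eta i0) t) else regat (Some a) h.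
  exact: principal_parts.
have [h hP] := choice hh.
have hreg i a : copen i (Some a) -> sections (Some a) (eta i - (eta i0 + finfun h)).
  move=> ia t; have := hP t a; case: ifP => as_ ht.
    have -> : eta i - (eta i0 + finfun h) =
        (eta i - eta (ix a)) - (finfun h - (eta (ix a) - eta i0)).
      by rewrite opprB -[_ - _ - finfun h]addrA subrKA opprD.
    rewrite coordsB; apply: regatB.
      exact: (heta _ _ _ ia (ixP a) t).
    by rewrite coordsB ffunE.
  rewrite opprD addrA coordsB; apply: regatB; last by rewrite ffunE.
  apply: (heta i i0 (Some a) ia _ t); apply: contrapT => i0a.
  have : (~` copen i0)%classic (Some a) by [].
  by rewrite sE /= => as'; move: as_; rewrite mem_pmap map_id as'.
have hinf t := line_h1_span (twisting t) ((eta i0 - (eta i0 + finfun h)) t).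
have [c cP] : exists c : forall t, 'I_(twisting t - 3) -> C, forall t, exists p,
    regat None (((eta i0 - (eta i0 + finfun h)) t - tofrac p -
      \sum_j Defs.scalar (c t j) * w ^+ j.+1) * z ^+ twisting t * w ^+ 2).
  by exists (fun t => sval (cid (hinf t))) => t; case: (cid _).
have [p pP] := choice cP.
have [c' c'E] := exists_comb (dim := fun t => (twisting t - 3)%N) c.
exists c', (- (eta i0 + finfun h) - [ffun t => tofrac (p t)]).
have reg_p a : sections (Some a) [ffun t => tofrac (p t)].
  by move=> t; rewrite ffunE; apply: regat_tofrac.
move=> i [] x xi; rewrite /standard_primitive.
  case: x xi => [a|] xi; last by case.
  move=> _; rewrite subr0 addrA; apply: sectionsB => //.
  exact: hreg.
move=> xj; case: x xi xj => [a|] xi xj.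
  rewrite addrA; apply: sectionsB => //; rewrite addrAC; apply: sectionsB; first exact: hreg.
  by apply: sections_comb_polar; apply/eqP => a0; apply: xj; rewrite a0.
have -> : eta i - comb polar c' + (- (eta i0 + finfun h) - [ffun t => tofrac (p t)])
    = (eta i - eta i0) + ((eta i0 - (eta i0 + finfun h)) - [ffun t => tofrac (p t)] - comb polar c').
  by rewrite -!addrA addKr; congr (_ + _); rewrite [LHS]addrC -!addrA.
apply: sectionsD; first exact: heta.
move=> t; have := pP t; rewrite /line_regular; congr (regat None (_ * _ * _)).
rewrite [in RHS]coordsB [in RHS]coordsB combE.
have -> : [ffun t => tofrac (p t)] t = tofrac (p t) by rewrite ffunE.
congr (_ - _); by apply: eq_bigr => j _; rewrite c'E.
Qed.

(** Uniqueness: two representations of a class differ by a generic section g' - g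
    without poles on the affine line, hence polynomial, so that a combination of
    the polar parts becomes a coboundary at infinity. *)
Lemma tangent_h1_lines : tangent_h1 C m #|h1_index|.
Proof.
exists standard_cover, (fun k => standard_cocycle (basis polar (enum_val k))).
split=> [k|V s cs].
  apply: standard_cocycleP => a a0 t; rewrite ffunE; case: eqP => _; last first.
    by have := sections0 (Some a) t; rewrite ffunE.
  by apply/regatX/regat_tofracV; rewrite hornerX.
have [i0 _] := coverP V None.
have [eta peta _] := cocycle_primitive i0 cs.
have heta i j x := @primitive_sections V s eta i j x cs peta.
pose sc (c : {ffun 'I_#|h1_index| -> C}) i j F :=
  \sum_k sscale (c k) (standard_cocycle (basis polar (enum_val k)) i j F).
have scE (c : {ffun 'I_#|h1_index| -> C}) : sc c = standard_cocycle (comb polar c).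
  apply/funext => i; apply/funext => j; apply/funext => F.
  rewrite /standard_cocycle derB.
  have E l : der (standard_primitive (comb polar c) l) F =
      \sum_k sscale (c k) (der (standard_primitive (basis polar (enum_val k)) l) F).
    case: l; last exact: der_comb.
    rewrite /standard_primitive der0 big1 // => k _; apply/ffunP => I.
    by rewrite !ffunE mulr0.
  rewrite !E -sumrB; apply: eq_bigr => k _; rewrite /standard_cocycle derB.
  by apply/ffunP => I; rewrite !ffunE mulrBr.
have cohP (c : {ffun 'I_#|h1_index| -> C}) : cohomologous s (sc c) <->
    exists g, forall i (j : bool) x, copen i x -> standard_open j x ->
    sections x (eta i - standard_primitive (comb polar c) j + g).
  rewrite scE; apply: cohomologousP => //; apply: standard_cocycleP => a a0.
  exact: sections_comb_polar.
have [c cP] := cocycle_standard heta.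
exists c; split=> [|c' /cohP[g' g'P]]; first exact/cohP.
have [g gP] := cP.
have E (u u' a b b' : coords) : (u - b + a) - (u - b' + u') = (a - u') - (b - b').
  by rewrite opprD addrACA (opprB u b') [u - b + _]addrC subrKA opprB addrC.
have gpoly a : sections (Some a) (g' - g).
  have [i ia] := coverP V (Some a); have ta : standard_open true (Some a) by [].
  have := sectionsB (g'P i true _ ia ta) (gP i true _ ia ta).
  by rewrite E subrr subr0.
apply: comb_coef_inj => t j; apply/esym/eqP; rewrite -subr_eq0; apply/eqP; move: j.
have [|p pE] := @regat_affine_poly _ ((g' - g) t); first by move=> a; apply: gpoly.
have [i xi] := coverP V None; have tf : standard_open false (None : P1 C) by [].
have := sectionsB (g'P i false _ xi tf) (gP i false _ xi tf).
rewrite E => /(_ t); rewrite /line_regular coordsB pE.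
have N y : - ((- y) t) = y t by rewrite ffunE opprK.
rewrite -[comb polar c' - _]opprB N comb_polarB => /line_h1_free h j.
by rewrite -opprB h oppr0.
Qed.

End Cohomology.

(** * Counting *)

Section Counting.

Import mathcomp.boot.fintype mathcomp.boot.finset.

Variable m : nat.
Implicit Types (phi : nat -> rat) (I J : {set 'I_m}).

Lemma card_basis_index (dim : lines m -> nat) : #|basis_index dim| = (\sum_(t : lines m) dim t)%N.
Proof.
rewrite card_tagged sumnE big_map big_enum; apply: eq_bigr => t _.
by rewrite card_ord.
Qed.

Lemma sum_lines (F : lines m -> rat) :
  \sum_(t : lines m) F t = \sum_(I : {set 'I_m}) F (None, I) + \sum_(i < m) \sum_(I : {set 'I_m}) F (Some i, I).
Proof.
rewrite (eq_bigr (fun t => F (t.1, t.2))) => [|[]//].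
rewrite -(pair_bigA _ (fun o I => F (o, I))) /= (bigD1 None) //=; congr (_ + _).
rewrite (reindex_omap Some id) /=; last by case.
by apply: eq_bigl => i; rewrite eqxx.
Qed.

(** The pairs (i, J) whose exponent is |J| instead of |J| + 1 correspond to the proper
    subsets I of the index set, by J = I U {i} with i the first index outside I. *)
Lemma sum_pivots (G : nat -> rat) :
  \sum_(i < m) \sum_(J : {set 'I_m} | (i \in J) && (first_out (J :\ i) == Some i)) G #|J|
  = \sum_(I : {set 'I_m}) if first_out I is Some _ then G #|I|.+1 else 0.
Proof.
transitivity (\sum_(i < m) \sum_(I : {set 'I_m} | first_out I == Some i) G #|I|.+1).
  apply: eq_bigr => i _.
  rewrite (reindex_onto (fun I => i |: I) (fun J => J :\ i)) => [|J /andP[iJ _]]; last exact: setD1K.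
  apply: eq_big => [I|I].
    rewrite !inE eqxx /=; apply/andP/eqP => [[/eqP Ii /eqP E]|Ii]; first by rewrite -E.
    by rewrite setU1K ?(first_out_notin Ii) // Ii.
  rewrite !inE eqxx /= => /andP[/eqP Ii /eqP E]; rewrite E in Ii.
  by rewrite cardsU1 (first_out_notin Ii).
rewrite (exchange_big_dep (fun=> true)) //=; apply: eq_bigr => I _.
case: (first_out I) => [j|]; last by rewrite big_pred0.
by rewrite (big_pred1 j) // => i; rewrite eq_sym (inj_eq Some_inj).
Qed.

Lemma first_outT : first_out [set: 'I_m] = None.
Proof. by rewrite /first_out; case: pickP => // i; rewrite inE. Qed.

Lemma sum_first_out (A B : nat -> rat) :
  \sum_(I : {set 'I_m}) (if first_out I is Some _ then A #|I| else B #|I|) =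
  \sum_(I : {set 'I_m}) A #|I| + (B m - A m).
Proof.
rewrite (bigD1 [set: 'I_m]) //= [in RHS](bigD1 [set: 'I_m]) //= first_outT.
rewrite cardsT card_ord [RHS]addrAC [A m + _]addrC subrK; congr (_ + _).
apply: eq_bigr => I IT; case: first_outP => // IE.
by rewrite IE eqxx in IT.
Qed.

(** Up to a second difference coming from the full set, the sum is as if every set I
    contributed m + 2 lines with exponent |I| + 1 and, negatively, one with exponent
    |I| + 2. *)
Lemma sum_twisting phi : \sum_(t : lines m) phi (twisting t) =
  \sum_(I : {set 'I_m}) ((m%:R + 2) * phi #|I|.+1 - phi #|I|.+2)
  + (phi m - 2 * phi m.+1 + phi m.+2).
Proof.
rewrite sum_lines.
have -> : \sum_(i < m) \sum_(I : {set 'I_m}) phi (twisting (Some i, I)) =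
    m%:R * (\sum_(I : {set 'I_m}) phi #|I|.+1) +
    \sum_(I : {set 'I_m}) if first_out I is Some _ then phi #|I|.+1 - phi #|I|.+2 else 0.
  rewrite -(sum_pivots (fun n => phi n - phi n.+1)).
  rewrite -[in m%:R](card_ord m) mulr_natl -sumr_const -big_split /=.
  apply: eq_bigr => i _; rewrite [X in _ + X]big_mkcond -big_split; apply: eq_bigr => J _ /=.
  by rewrite /twisting /=; case: ifP => _; rewrite ?addn0 ?addn1 ?addr0 // addrC subrK.
rewrite (eq_bigr (fun I => if first_out I is Some _ then phi #|I|.+1 else phi #|I|)); last first.
  by move=> I _; rewrite /twisting /=; case: first_out => [j|]; rewrite ?addn0 ?addn1.
rewrite (sum_first_out (fun n => phi n.+1) phi).
rewrite (sum_first_out (fun n => phi n.+1 - phi n.+2) (fun=> 0)).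
rewrite !sumrB -mulr_sumr; ring.
Qed.

Lemma sum_card_eq n : \sum_(I : {set 'I_m}) (#|I| == n)%:R = 'C(m, n)%:R :> rat.
Proof.
rewrite -natr_sum; congr (_%:R); rewrite -[in RHS](card_ord m) -card_draws -sum1_card.
by rewrite [RHS]big_mkcond; apply: eq_bigr => I _; rewrite inE; case: eqP.
Qed.

Lemma card_sets : \sum_(I : {set 'I_m}) 1 = 2 ^+ m :> rat.
Proof.
by rewrite sumr_const -cardsT -powersetT card_powerset cardsT card_ord natrX.
Qed.

(** A set and its complement have m elements together. *)
Lemma sum_card : \sum_(I : {set 'I_m}) #|I|%:R = m%:R * 2 ^+ m / 2 :> rat.
Proof.
have : \sum_(I : {set 'I_m}) #|I|%:R + \sum_(I : {set 'I_m}) #|I|%:R = m%:R * 2 ^+ m :> rat.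
  rewrite {1}(reindex_inj (@setC_inj _)) -big_split /= -card_sets mulr_sumr.
  apply: eq_bigr => I _; rewrite mulr1 -natrD.
  by rewrite addnC cardsC card_ord.
by move=> <-; field.
Qed.

Lemma h0_count : m <> 2%N ->
  \sum_(t : lines m) (3 - twisting t)%N%:R = (m%:R + 2) ^+ 2 - 1 :> rat.
Proof.
move=> m2; rewrite (sum_twisting (fun e => (3 - e)%N%:R)).
rewrite (eq_bigr (fun I => (#|I| == 0)%:R * (2 * m%:R + 3) + (#|I| == 1)%:R * (m%:R + 2))).
  rewrite big_split -!mulr_suml !sum_card_eq bin0 bin1 /=.
  have -> : (3 - m)%N%:R - 2 * (3 - m.+1)%N%:R + (3 - m.+2)%N%:R = 0 :> rat.
    by case: (m) m2 => [|[|[|n]]] // _; rewrite !(subSS, subn0, sub0n); ring.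
  by ring.
by move=> I _; case: #|I| => [|[|n]]; rewrite !(subSS, subn0, sub0n) /=; ring.
Qed.

(** By Riemann-Roch the line bundle of degree 2 - e has Euler characteristic 3 - e. *)
Lemma euler_characteristic :
  \sum_(t : lines m) (3 - (twisting t)%:R) = (2 * m%:R + 3) * 2 ^+ m - (m%:R + 1) * (m%:R * 2 ^+ m / 2) :> rat.
Proof.
rewrite (sum_twisting (fun e => 3 - e%:R)).
have -> : 3 - m%:R - 2 * (3 - m.+1%:R) + (3 - m.+2%:R) = 0 :> rat.
  by rewrite -(addn2 m) -(addn1 m) !natrD; ring.
rewrite addr0 -sum_card mulr_sumr.
rewrite -card_sets mulr_sumr -sumrB; apply: eq_bigr => I _.
by rewrite -(addn2 #|I|) -(addn1 #|I|) !natrD; ring.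
Qed.

Lemma h1_count : m <> 2%N -> \sum_(t : lines m) (twisting t - 3)%N%:R =
  (m%:R + 2) * ((m%:R + 2) + (m%:R - 4) * 2 ^ (m%:Z - 1)) - (m%:R - 2) * 2 ^ (m%:Z - 1) - 1 :> rat.
Proof.
move=> m2.
transitivity (\sum_(t : lines m) ((3 - twisting t)%N%:R - (3 - (twisting t)%:R)) : rat).
  apply: eq_bigr => t _; case: (leqP (twisting t) 3) => [e3|e3].
    by rewrite (eqP e3) natrB // subrr.
  have -> : (3 - twisting t = 0)%N by apply/eqP; exact: ltnW.
  by rewrite natrB ?(ltnW e3) // sub0r opprB.
rewrite sumrB h0_count // euler_characteristic.
have -> : 2 ^ (m%:Z - 1) = 2 ^+ m / 2 :> rat by rewrite expfzDr.
by field.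
Qed.

End Counting.

Theorem mainTheorem9 (R : realType) (m : nat) (hm : m <> 2%N) :
  exists h0 h1 : nat,
    [/\ tangent_h0 R[i] m h0,
        tangent_h1 R[i] m h1,
        h0%:R = (m%:R + 2) ^+ 2 - 1 :> rat,
        (m%:R + 2) ^+ 2 - 1 = m%:R ^+ 2 + 4 * m%:R + 3 :> rat
      & h1%:R = (m%:R + 2) * ((m%:R + 2) + (m%:R - 4) * 2 ^ (m%:Z - 1))
                - (m%:R - 2) * 2 ^ (m%:Z - 1) - 1 :> rat].
Proof.
exists #|h0_index m|, #|h1_index m|; split.
- exact: tangent_h0_lines.
- exact: tangent_h1_lines.
- by rewrite card_basis_index natr_sum h0_count.
- by ring.
- by rewrite card_basis_index natr_sum h1_count.
Qed.
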